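(* Consider the resource allocation problem $$\min_{y\in\mathbb{R}^{Nn}} \sum_{i=1}^N f_i(y_i)\quad\text{subject to}\quad \sum_{i=1}^N y_i=\sum_{i=1}^N d_i,\quad y_i\in\Omega_i,\ i=1,\dots,N, \qquad (P)$$ with $y=\mathrm{col}(y_1,\dots,y_N)$, $d_i\in\mathbb{R}^n$, and each $\Omega_i\subset\mathbb{R}^n$ closed and convex. Suppose Slater's condition holds (there exist $z_i$ in the relative interior of $\Omega_i$, $i=1,\dots,N$, with $\sum_i z_i=\sum_i d_i$), each $f_i$ is convex and locally Lipschitz continuous, and each $f_i$ is $\omega$-strongly convex on $\Omega_i$ for some $\omega>0$. Suppose the communication graph is a strongly connected and weight-balanced digraph with Laplacian $L$, let $\hat\lambda_2$ be the smallest positive eigenvalue of $(L+L^T)/2$, and let $$k_1>\frac{\|L\|^2}{\hat\lambda_2\,\omega},\qquad k_2>\frac{k_1^2}{\hat\lambda_2^2},\qquad k_3>0 .$$ Consider the algorithm, for $i=1,\dots,N$, $$\begin{cases}\dot x_i\in y_i-x_i-\partial f_i(y_i)+s_i\\ \dot s_i=k_1(w_i-y_i+d_i)+k_2\sum_{j=1}^N a_{ij}(s_j-s_i)\\ \dot w_i=k_3\sum_{j=1}^N a_{ij}\big((w_j-y_j+d_j)-(w_i-y_i+d_i)\big)\\ y_i=P_{\Omega_i}(x_i).\end{cases}$$ If the initial point satisfies $\sum_{i=1}^N w_i(0)=0_n$, then the algorithm converges asymptotically to the optimum of $(P)$: for every solution with such an initial point, $\lim_{t\to\infty}y(t)=y^*$,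 where $y^*$ is the optimal solution of $(P)$.
   Context: $N\ge 2$ agents. Each $f_i$ is a (possibly nonsmooth) real-valued function defined on an open convex neighbourhood of $\Omega_i$ (for instance all of $\mathbb{R}^n$), on which it is convex and locally Lipschitz; $\partial f_i$ is the Clarke generalized gradient, which for convex $f_i$ is the convex subdifferential. $f_i$ is $\omega$-strongly convex on $\Omega_i$ if $(p-q)^T(\gamma_p-\gamma_q)\ge\omega\|p-q\|^2$ for all $p,q\in\Omega_i$, $\gamma_p\in\partial f_i(p)$, $\gamma_q\in\partial f_i(q)$. $P_{\Omega}(p)=\arg\min_{q\in\Omega}\|p-q\|$ is the Euclidean projection onto a closed convex set $\Omega$. $\mathrm{col}(\cdot)$ denotes stacking of column vectors, $0_n$ the zero vector of $\mathbb{R}^n$, $\|\cdot\|$ the Euclidean norm of vectors and the spectral norm of matrices. The communication graph has nodes $1,\dots,N$ and weighted adjacency matrix $\mathcal{A}=(a_{ij})$ with $a_{ij}\ge0$ and $a_{ij}>0$ iff node $i$ can receive information from node $j$. Its Laplacian is $L=\mathrm{diag}(\sum_j a_{1j},\dots,\sum_j a_{Nj})-\mathcal{A}$. The digraph is weight-balanced if $\sum_j a_{ij}=\sum_j a_{ji}$ for all $i$ (equivalently $1_N^TL=0_N^T$). For a strongly connected weight-balanced digraph, $0$ is a simple eigenvalue of the positive semidefinite matrix $(L+L^T)/2$. The variables are $x_i,s_i,w_i\in\mathbb{R}^n$, and $y=\mathrm{col}(y_1,\dots,y_N)$. A solution is a Carathéodory solution on $[0,\infty)$: $(x,s,w)$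 is (locally) absolutely continuous and satisfies the inclusion and equations for almost every $t$, with $y_i(t)=P_{\Omega_i}(x_i(t))$. *)

(* Defs.v *)
From HB Require Import structures.
From mathcomp Require Export all_boot all_order all_algebra.
From mathcomp Require Export all_classical all_reals all_analysis.

Set Implicit Arguments.
Unset Strict Implicit.
Unset Printing Implicit Defensive.

Export Order.TTheory GRing.Theory Num.Theory.
Export numFieldNormedType.Exports.

Local Open Scope classical_set_scope.
Local Open Scope ring_scope.

(* Vectors of R^n are column vectors; a stacked vector col(y_1, ..., y_N) is
   represented by the family y : 'I_N -> 'cV[R]_n.

   The library norm `|.| on 'cV[R]_n is the sup norm. It is used below only in
   notions that do not depend on the choice of a norm on R^n (Lipschitz and
   absolutely continuous functions, limits, derivatives); metric notions
   (projections, spectral norm, strong convexity) use the Euclidean norm. *)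

Section euclidean.
Variables (R : realType) (n : nat).
Implicit Types u v : 'cV[R]_n.

Definition dotv u v : R := (u^T *m v) 0 0.

Definition enorm u : R := Num.sqrt (dotv u u).

End euclidean.

Definition spectral_norm (R : realType) (m n : nat) (A : 'M[R]_(m, n)) : R :=
  sup [set enorm (A *m v) | v in [set v : 'cV[R]_n | enorm v <= 1]].

Definition smallest_pos_eigenvalue (R : realType) (n : nat) (M : 'M[R]_n)
    (lambda : R) : Prop :=
  [/\ 0 < lambda, eigenvalue M lambda &
      forall mu, 0 < mu -> eigenvalue M mu -> lambda <= mu].

Section convex_analysis.
Variables (R : realType) (n : nat).
Implicit Types (C U : set 'cV[R]_n) (f : 'cV[R]_n -> R) (p q v : 'cV[R]_n).

Definition affine_hull C : set 'cV[R]_n :=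
  [set p | exists (m : nat) (c : 'I_m -> R) (a : 'I_m -> 'cV[R]_n),
     [/\ forall k, C (a k), \sum_k c k = 1 & p = \sum_k c k *: a k]].

Definition relative_interior C : set 'cV[R]_n :=
  [set p | C p /\ \forall q \near p, affine_hull C q -> C q].

Definition argmin_dist C p : set 'cV[R]_n :=
  [set q | C q /\ forall z, C z -> enorm (p - q) <= enorm (p - z)].

(* The default value 0 is only taken when the argmin is empty, which does not
   happen for C closed and nonempty. *)
Definition proj C p : 'cV[R]_n := xget 0 (argmin_dist C p).

Definition locally_lipschitz_on U f : Prop :=
  forall p, U p ->
    exists2 V : set 'cV[R]_n, nbhs p V & [lipschitz f q | q in V].

(* f°(p; v) = limsup_{q -> p, t -> 0+} (f (q + t v) - f q) / t *)
Definition clarke_dirderiv f p v : \bar R :=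
  limf_esup
    (fun qt : 'cV[R]_n * R => ((f (qt.1 + qt.2 *: v) - f qt.1) / qt.2)%:E)
    (filter_prod (nbhs p) 0^'+).

(* This only depends on the germ of f at p, hence makes sense for a function f
   that is meaningful only on an open set containing p. *)
Definition clarke_gradient f p : set 'cV[R]_n :=
  [set g | forall v, ((dotv g v)%:E <= clarke_dirderiv f p v)%E].

Definition strongly_convex_on (omega : R) C f : Prop :=
  forall p q gp gq, C p -> C q ->
    clarke_gradient f p gp -> clarke_gradient f q gq ->
    omega * enorm (p - q) ^+ 2 <= dotv (p - q) (gp - gq).

End convex_analysis.

Section digraph.
Variables (R : realType) (N : nat) (A : 'M[R]_N).

(* A i j > 0 iff i receives information from j: an arc from j to i. *)
Definition arc : rel 'I_N := [rel j i | 0 < A i j].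

Definition strongly_connected : Prop := forall i j, connect arc i j.

Definition weight_balanced : Prop :=
  forall i, \sum_j A i j = \sum_j A j i.

Definition laplacian : 'M[R]_N := diag_mx (\row_i \sum_j A i j) - A.

End digraph.

Section resource_allocation.
Variables (R : realType) (N n : nat).
Variables (f : 'I_N -> 'cV[R]_n -> R) (Omega : 'I_N -> set 'cV[R]_n).
Variable d : 'I_N -> 'cV[R]_n.

Definition feasible (y : 'I_N -> 'cV[R]_n) : Prop :=
  \sum_i y i = \sum_i d i /\ forall i, Omega i (y i).

Definition optimal (y : 'I_N -> 'cV[R]_n) : Prop :=
  feasible y /\
  forall z, feasible z -> \sum_i f i (y i) <= \sum_i f i (z i).

Definition slater : Prop :=
  exists z : 'I_N -> 'cV[R]_n,
    (forall i, relative_interior (Omega i) (z i)) /\ \sum_i z i = \sum_i d i.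

End resource_allocation.

Definition abs_continuous (R : realType) (V : normedModType R) (a b : R)
    (g : R -> V) : Prop :=
  forall e : R, 0 < e -> exists2 delta : R, 0 < delta &
    forall (m : nat) (l r : 'I_m -> R),
      (forall k, [/\ a <= l k, l k <= r k & r k <= b]) ->
      trivIset [set: 'I_m] (fun k => `]l k, r k[%classic) ->
      \sum_k (r k - l k) < delta ->
      \sum_k `|g (r k) - g (l k)| < e.

Definition locally_abs_continuous (R : realType) (V : normedModType R)
    (g : R -> V) : Prop :=
  forall T : R, 0 < T -> abs_continuous 0 T g.

Section algorithm.
Variables (R : realType) (N n : nat).
Variables (f : 'I_N -> 'cV[R]_n -> R) (Omega : 'I_N -> set 'cV[R]_n).
Variables (d : 'I_N -> 'cV[R]_n) (A : 'M[R]_N) (k1 k2 k3 : R).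

(* Trajectories are functions on R of which only the values on [0, +oo[ are
   relevant; the derivatives at time 0 do not matter, as {0} is negligible. *)
Implicit Types x s w : 'I_N -> R -> 'cV[R]_n.

Definition dynamics_at x s w (t : R) : Prop :=
  let y i : 'cV[R]_n := proj (Omega i) (x i t) in
  let u i : 'cV[R]_n := w i t - y i + d i in
  forall i,
    [/\ derivable (x i) t 1,
        [set y i - x i t - g + s i t | g in clarke_gradient (f i) (y i)]
          (derive1 (x i) t),
        is_derive t 1 (s i)
          (k1 *: u i + k2 *: \sum_j A i j *: (s j t - s i t)) &
        is_derive t 1 (w i) (k3 *: \sum_j A i j *: (u j - u i))].

Definition caratheodory_solution x s w : Prop :=
  [/\ forall i, locally_abs_continuous (x i),
      forall i, locally_abs_continuous (s i),
      forall i, locally_abs_continuous (w i) &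
      {ae @lebesgue_measure R, forall t, 0 <= t -> dynamics_at x s w t}].

End algorithm.

(* Main.v *)
Require Import Defs.
From mathcomp Require Import measurable_realfun ring lra.

Set Implicit Arguments.
Unset Strict Implicit.
Unset Printing Implicit Defensive.

Local Open Scope classical_set_scope.
Local Open Scope ring_scope.

(** The algorithm is a gradient flow on the primal side, coupled through
    consensus dynamics to estimates s_i of a common Lagrange multiplier, and
    its convergence is proved with one explicit Lyapunov function.

    Optimality.  Strong monotonicity of the gradients gives each f_i quadratic
    growth ([strong_growth]), so the objective attains its minimum over the
    closed feasible set at some ystar ([optimal_exists]).  Perturbing the
    constraints and separating the resulting values from the optimal one
    ([linear_minorant]), with Slater's condition as qualification, yields
    subgradients g_i of f_i at ystar_i and one multiplier sigma such
    that sigma - g_i is normal to Omega_i at ystar_i ([kkt]); with the quadratic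
    growth this also gives uniqueness.

    Lyapunov function.  For y = P(x), half of
    |x - ystar|^2 - |x - P(x)|^2 is a convex function of x whose gradient is
    P(x) - ystar and which dominates half of |P(x) - ystar|^2 ([proj_gap_lb],
    [proj_gap_ub], [proj_gap_ge]).  Writing Y = y - ystar, S = s - sigma and
    W = w - (ystar - d), the function
      V = sum_i gap_i(x_i) + |S|^2 / (2 k1) + |W|^2 / (2 k1 k3)
    satisfies V' <= - omega / 2 |Y|^2 along solutions ([lyapunov_derive]).
    Monotonicity of the gradients produces - omega |Y|^2 + Y . S, and the
    weight 1 / k1 makes the Y . S terms cancel.  What is left is the coordinatewise
    quadratic form of [dissipation]: since the sum of the W_i vanishes for all
    time, only the disagreement part of S meets W, and there the Laplacian is
    coercive with constant lambda2 ([centered_coercive]), so the two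
    gain conditions let Young's inequality absorb the cross terms.

    Convergence.  Solutions are only absolutely continuous, so decrease of V
    is deduced from the almost everywhere inequality by [abs_continuous_le].
    As V is bounded, so are y, s and the gradients of f_i at y_i; then x_i obeys
    a stable linear equation with bounded input, hence is Lipschitz in time
    ([x_lipschitz]), and an argument of Barbalat type ([barbalat]) forces
    |Y|^2, which V dissipates, to tend to 0. *)

(** * Inner products *)

Lemma sqr_le_norm (R : realType) (x B : R) :
  0 <= B -> x ^+ 2 <= B ^+ 2 -> `|x| <= B.
Proof. by move=> B0; rewrite -(real_normK (num_real x)) ler_sqr ?nnegrE. Qed.

Lemma sqr_le_normD1 (R : realType) (x B : R) : x ^+ 2 <= B -> `|x| <= 1 + B.
Proof.
move=> xB; have x0 := sqr_ge0 x.
apply: sqr_le_norm; first by lra.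
by rewrite sqrrD expr1n; have := sqr_ge0 B; nra.
Qed.

Section dot_product.
Variables (R : realType) (n : nat).
Implicit Types u v w : 'cV[R]_n.

Lemma dotvE u v : dotv u v = \sum_k u k 0 * v k 0.
Proof. by rewrite /dotv mxE; apply: eq_bigr => k _; rewrite mxE. Qed.

Lemma dotvC u v : dotv u v = dotv v u.
Proof. by rewrite !dotvE; apply: eq_bigr => k _; rewrite mulrC. Qed.

Lemma dotvDl u v w : dotv (u + v) w = dotv u w + dotv v w.
Proof. by rewrite /dotv linearD mulmxDl mxE. Qed.

Lemma dotvNl u w : dotv (- u) w = - dotv u w.
Proof. by rewrite /dotv linearN mulNmx mxE. Qed.

Lemma dotvBl u v w : dotv (u - v) w = dotv u w - dotv v w.
Proof. by rewrite dotvDl dotvNl. Qed.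

Lemma dotvZl c u w : dotv (c *: u) w = c * dotv u w.
Proof. by rewrite /dotv linearZ -scalemxAl mxE. Qed.

Lemma dotvDr u v w : dotv w (u + v) = dotv w u + dotv w v.
Proof. by rewrite !(dotvC w) dotvDl. Qed.

Lemma dotvNr u w : dotv w (- u) = - dotv w u.
Proof. by rewrite !(dotvC w) dotvNl. Qed.

Lemma dotvBr u v w : dotv w (u - v) = dotv w u - dotv w v.
Proof. by rewrite dotvDr dotvNr. Qed.

Lemma dotvZr c u w : dotv w (c *: u) = c * dotv w u.
Proof. by rewrite !(dotvC w) dotvZl. Qed.

Lemma dot0v u : dotv 0 u = 0.
Proof. by rewrite -(scale0r 0) dotvZl mul0r. Qed.

Lemma dotv0 u : dotv u 0 = 0.
Proof. by rewrite dotvC dot0v. Qed.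

Lemma dotv_sumr I (r : seq I) (F : I -> 'cV[R]_n) u :
  dotv u (\sum_(i <- r) F i) = \sum_(i <- r) dotv u (F i).
Proof.
elim: r => [|i r ih]; first by rewrite !big_nil dotv0.
by rewrite !big_cons dotvDr ih.
Qed.

Lemma dotv_ge0 u : 0 <= dotv u u.
Proof. by rewrite dotvE sumr_ge0// => k _; rewrite -expr2 sqr_ge0. Qed.

Lemma dotv_eq0 u : (dotv u u == 0) = (u == 0).
Proof.
apply/eqP/eqP => [|->]; last exact: dotv0.
rewrite dotvE => /eqP; rewrite psumr_eq0; last first.
  by move=> k _; rewrite -expr2 sqr_ge0.
move=> /allP u0; apply/colP => k; rewrite mxE.
have := u0 k (mem_index_enum k).
by rewrite -expr2 sqrf_eq0 => /eqP.
Qed.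

Lemma enorm_sqr u : enorm u ^+ 2 = dotv u u.
Proof. by rewrite /enorm sqr_sqrtr// dotv_ge0. Qed.

Lemma enorm_ge0 u : 0 <= enorm u.
Proof. exact: sqrtr_ge0. Qed.

Lemma enorm_le u v : (enorm u <= enorm v) = (dotv u u <= dotv v v).
Proof. by rewrite -(ler_sqr (enorm_ge0 u)) ?nnegrE ?enorm_ge0// !enorm_sqr. Qed.

Definition dotvL := (dotvDl, dotvNl, dotvZl, dotvDr, dotvNr, dotvZr).

Lemma young_dotv (c : R) u v : 0 < c ->
  dotv u v <= c * dotv u u + (4 * c)^-1 * dotv v v.
Proof.
move=> c0; have := dotv_ge0 (c *: u - 2^-1 *: v).
rewrite !dotvL (dotvC v u) => h.
rewrite -(ler_pM2l c0).
have -> : c * (c * dotv u u + (4 * c)^-1 * dotv v v) =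
  c * (c * dotv u u) + 4^-1 * dotv v v by field; rewrite gt_eqF.
lra.
Qed.

Lemma sqr_coord_le u k : (u k 0) ^+ 2 <= dotv u u.
Proof.
rewrite dotvE (bigD1 k)//= -expr2 lerDl sumr_ge0// => j _.
by rewrite -expr2 sqr_ge0.
Qed.

End dot_product.

(** * A Hahn-Banach theorem in finite dimension *)

Section linear_minorant.
Variables (R : realType) (I : finType) (C : (I -> R) -> R -> Prop).
Hypothesis C_convex : forall b r b' r' t, 0 < t -> t < 1 -> C b r -> C b' r' ->
  C (fun i => t * b i + (1 - t) * b' i) (t * r + (1 - t) * r').
Hypothesis C_opp : forall b r, C b r ->
  exists2 t, 0 < t & exists r', C (fun i => - t * b i) r'.
Hypothesis C_ge0 : forall b r, C b r -> (forall i, b i = 0) -> 0 <= r.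

(** Hahn-Banach in finite dimension, as a non-vertical supporting hyperplane
    at the origin. C_opp keeps the hyperplane from being vertical. The
    functional is built one coordinate at a time: at a new coordinate i, the
    slopes forced from above by the points with positive i-th entry lie above
    those forced from below by the points with negative i-th entry, because a
    convex combination of the two kinds has i-th entry 0, a case already
    settled. *)
Lemma linear_minorant :
  exists s : I -> R, forall b r, C b r -> \sum_i s i * b i <= r.
Proof.
suff H : forall J : seq I, exists s : I -> R, forall b r, C b r ->
    (forall i, i \notin J -> b i = 0) -> \sum_i s i * b i <= r.
  have [s sP] := H (enum I); exists s => b r Cbr; apply: (sP b r Cbr) => i.
  by rewrite mem_enum.
elim=> [|i J [s sP]].
  exists (fun=> 0) => b r Cbr b0; rewrite big1 => [|i _]; last by rewrite mul0r.
  by apply: (C_ge0 Cbr) => i; exact: b0.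
(* What is left for the new coordinate once the other slopes are fixed. *)
pose rho (b : I -> R) r := r - \sum_(j | j != i) s j * b j.
pose off (b : I -> R) := forall j, j \notin i :: J -> b j = 0.
have cross b r b' r' : C b r -> C b' r' -> off b -> off b' ->
    0 < b i -> b' i < 0 -> rho b' r' / b' i <= rho b r / b i.
  move=> Cb Cb' ob ob' bi b'i.
  have D0 : 0 < b i - b' i by lra.
  (* The weight for which the i-th entries cancel. *)
  pose t := - b' i / (b i - b' i).
  have t0 : 0 < t by rewrite divr_gt0// oppr_gt0.
  have t1 : 1 - t = b i / (b i - b' i) by rewrite /t; field; rewrite gt_eqF.
  have t1' : 0 < 1 - t by rewrite t1 divr_gt0.
  have tlt : t < 1 by lra.
  have := sP _ _ (C_convex t0 tlt Cb Cb').
  have z0 : t * b i + (1 - t) * b' i = 0.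
    by rewrite t1 /t; field; rewrite gt_eqF.
  have -> : \sum_j s j * (t * b j + (1 - t) * b' j) =
     t * (\sum_(j | j != i) s j * b j) + (1 - t) * \sum_(j | j != i) s j * b' j.
    rewrite (bigD1 i)//= z0 mulr0 add0r !mulr_sumr -big_split/=.
    by apply: eq_bigr => j _; ring.
  have offz j : j \notin J -> t * b j + (1 - t) * b' j = 0.
    move=> jJ; have [->//|ji] := eqVneq j i.
    by rewrite ob ?ob' ?inE ?negb_or ?ji//; ring.
  move=> /(_ offz) h.
  have {}h : 0 <= t * rho b r + (1 - t) * rho b' r' by rewrite /rho; lra.
  rewrite ler_pdivlMr// mulrAC ler_ndivrMr// -subr_ge0.
  have := mulr_ge0 (ltW D0) h; rewrite t1 /t.
  have -> : (b i - b' i) * (- b' i / (b i - b' i) * rho b r +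
     b i / (b i - b' i) * rho b' r') = - b' i * rho b r + b i * rho b' r'.
    by field; rewrite gt_eqF.
  lra.
pose S := [set q | exists b r, [/\ C b r, off b, 0 < b i & q = rho b r / b i]].
(* If S is empty, then b i = 0 throughout C by C_opp, so that the default
   value of c is harmless. *)
pose c := inf S.
exists (fun j => if j == i then c else s j) => b r Cb ob.
have -> : \sum_j (if j == i then c else s j) * b j =
    c * b i + \sum_(j | j != i) s j * b j.
  rewrite (bigD1 i)//= eqxx; congr (_ + _).
  by apply: eq_bigr => j /negbTE ->.
suff : c * b i <= rho b r by rewrite /rho; lra.
have [bi|bi|bi] := ltgtP (b i) 0.
- have [t t0 [r' Cb']] := C_opp Cb.
  have b'i : 0 < - t * b i by rewrite nmulr_rgt0// oppr_lt0.
  have ob' : off (fun i => - t * b i) by move=> j /ob ->; rewrite mulr0.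
  rewrite -ler_ndivrMr//; apply: lb_le_inf.
    by exists (rho (fun i => - t * b i) r' / (- t * b i)), (fun i => - t * b i), r'.
  by move=> _ [b1 [r1 [Cb1 ob1 b1i ->]]]; exact: cross.
- rewrite -ler_pdivlMr//; apply: ge_inf; last by exists b, r.
  have [t t0 [r' Cb']] := C_opp Cb.
  have b'i : - t * b i < 0 by rewrite mulNr oppr_lt0 mulr_gt0.
  have ob' : off (fun i => - t * b i) by move=> j /ob ->; rewrite mulr0.
  exists (rho (fun i => - t * b i) r' / (- t * b i)).
  by move=> _ [b1 [r1 [Cb1 ob1 b1i ->]]]; exact: cross Cb1 Cb' _ _ _ _.
- rewrite bi mulr0 /rho subr_ge0.
  have := sP _ _ Cb; rewrite (bigD1 i)//= bi mulr0 add0r; apply => j jJ.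
  have [->//|ji] := eqVneq j i.
  by apply: ob; rewrite inE negb_or ji.
Qed.

End linear_minorant.

(** * Topology of matrix spaces *)

Section matrix_topology.
Variable R : realType.

Lemma ler_mx_norm m n (M : 'M[R]_(m, n)) i j : `|M i j| <= `|M|.
Proof.
rewrite [leRHS]/Num.Def.normr/= mx_normrE.
exact: (le_bigmax _ (fun ij : 'I_m * 'I_n => `|M ij.1 ij.2|) (i, j)).
Qed.

Lemma mx_norm_ler m n (M : 'M[R]_(m, n)) (B : R) : 0 <= B ->
  (forall i j, `|M i j| <= B) -> `|M| <= B.
Proof.
move=> B0 MB; rewrite [leLHS]/Num.Def.normr/= mx_normrE.
by apply: bigmax_le => // ij _; exact: MB.
Qed.

Lemma cvg_mx (T : Type) (F : set_system T) {FF : Filter F} m n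
    (g : T -> 'M[R]_(m, n)) (M : 'M[R]_(m, n)) :
  (forall i j, g x i j @[x --> F] --> M i j) -> g x @[x --> F] --> M.
Proof.
move=> gM A [P MP PA]; apply: (@filterS _ F _
  [set x | forall i j, P i j (g x i j)]); first by move=> x Px; exact: PA.
apply: filter_forall => i; apply: filter_forall => j.
exact: gM (MP i j).
Qed.

Lemma continuous_mx (T : topologicalType) m n (g : T -> 'M[R]_(m, n)) :
  (forall i j, continuous (fun x => g x i j)) -> continuous g.
Proof. by move=> gc x; apply: (@cvg_mx _ (nbhs x)) => i j; exact: gc. Qed.

(** Flattening a matrix to a row vector is a homeomorphism, and bounded closed
    sets of row vectors are compact. *)
Lemma mx_bounded_closed_compact m n (A : set 'M[R]_(m, n)) (B : R) :
  (forall M, A M -> forall i j, `|M i j| <= B) -> closed A -> compact A.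
Proof.
move=> AB clA.
have vc : continuous (@vec_mx R m n).
  apply: continuous_mx => i j; under eq_fun do rewrite mxE.
  exact: coord_continuous.
have -> : A = vec_mx @` (vec_mx @^-1` A).
  apply/seteqP; split=> [M AM|_ [v Av <-]//].
  by exists (mxvec M); rewrite /= ?mxvecK.
apply: continuous_compact; first exact/continuous_subspaceT.
apply: bounded_closed_compact; last by apply: preimage_closed => // v _; exact: vc.
exists `|B|; split => // B' BB' v Av /=.
apply: mx_norm_ler; first by rewrite (le_trans _ (ltW BB')).
move=> i j; rewrite ord1 -(vec_mxK v).
case/mxvec_indexP: j => i' j'; rewrite mxvecE (le_trans (AB _ Av _ _))//.
by rewrite (le_trans (ler_norm B))// ltW.
Qed.

End matrix_topology.

(** * Convex subgradients and Clarke gradients *)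

Section convexity.
Variables (R : realType) (n : nat).
Implicit Types (C U : set 'cV[R]_n) (f : 'cV[R]_n -> R) (p q : 'cV[R]_n).

Lemma convex_setE C p q (t : R) : convex_set C -> 0 <= t -> t <= 1 ->
  C p -> C q -> C (t *: p + (1 - t) *: q).
Proof.
move=> cC t0 t1 Cp Cq.
by have := cC p q (Itv01 t0 t1) (mem_set Cp) (mem_set Cq); rewrite inE.
Qed.

Lemma convex_functionE C f p q (t : R) :
  convex_function C f -> 0 <= t -> t <= 1 -> C p -> C q ->
  f (t *: p + (1 - t) *: q) <= t * f p + (1 - t) * f q.
Proof.
move=> cf t0 t1 Cp Cq.
exact: (cf (Itv01 t0 t1) p q (mem_set Cp) (mem_set Cq)).
Qed.

End convexity.

Section dirderiv.
Variables (R : realType) (n : nat).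
Implicit Types (C U : set 'cV[R]_n) (f : 'cV[R]_n -> R) (p q v g : 'cV[R]_n).

(** The convex subdifferential relative to U. Existence and calculus are easy
    for it, and it is contained in the Clarke gradient at the interior points
    of U. *)
Definition subgradient U f p : set 'cV[R]_n :=
  [set g | forall u, U u -> f p + dotv g (u - p) <= f u].

Lemma near_ray U p v : nbhs p U -> \forall t \near (0 : R)^'+, U (p + t *: v).
Proof.
move=> pU.
have : p + t *: v @[t --> (0 : R)^'+] --> p.
  rewrite -[X in _ --> X]addr0 -(scale0r v); apply: cvgD; first exact: cvg_cst.
  by apply: cvgZr_tmp; exact: cvg_at_right_filter.
exact.
Qed.

(** The difference quotients at p itself already bound the inner product with
    g from above, and they take part in the upper limit that defines the
    generalized derivative. *)
Lemma subgradient_clarke U f p g :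
  nbhs p U -> subgradient U f p g -> clarke_gradient f p g.
Proof.
move=> pU gP v; rewrite /clarke_dirderiv limf_esupE.
apply: le_ereal_inf_tmp => _ [V FV <-].
case: FV => -[A B] /= [pA B0] ABV.
near (0 : R)^'+ => t.
have t0 : 0 < t by [].
apply: (@le_trans _ _ ((f (p + t *: v) - f p) / t)%:E).
  rewrite lee_fin ler_pdivlMr// mulrC -dotvZr lerBrDl.
  have Upt : U (p + t *: v) by near: t; exact: near_ray.
  by rewrite (le_trans _ (gP _ Upt))// (addrC p) addrK.
apply: ereal_sup_ubound; exists (p, t) => //.
apply: ABV; split => /=; first exact: nbhs_singleton.
by near: t.
Unshelve. all: by end_near. Qed.

(** The epigraph of f, translated to p, is a convex set to which the minorant
    theorem applies: U being open, every direction can be reversed. *)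
Lemma subgradient_exists U f p : open U -> convex_set U ->
  convex_function U f -> U p -> subgradient U f p !=set0.
Proof.
move=> oU cU cf Up.
pose C (b : 'I_n -> R) (r : R) :=
  exists u, [/\ U u, forall k, b k = (u - p) k 0 & f u - f p <= r].
have [|||s sP] := @linear_minorant R 'I_n C.
- move=> b r b' r' t t0 t1 [u [Uu bu ur]] [u' [Uu' bu' ur']].
  exists (t *: u + (1 - t) *: u'); split; first by apply: convex_setE => //; exact: ltW.
    by move=> k; rewrite bu bu' !mxE; ring.
  have := convex_functionE cf (ltW t0) (ltW t1) Uu Uu'.
  have : t * (f u - f p) <= t * r by rewrite ler_pM2l.
  have : (1 - t) * (f u' - f p) <= (1 - t) * r' by rewrite ler_pM2l// subr_gt0.
  lra.
- move=> b r [u [Uu bu ur]].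
  near (0 : R)^'+ => t.
  exists t => //; exists (f (p + t *: (p - u)) - f p), (p + t *: (p - u)); split => //.
    by near: t; apply: near_ray; exact: open_nbhs_nbhs.
  by move=> k; rewrite bu !mxE; ring.
- move=> b r [u [Uu bu ur]] b0; rewrite (le_trans _ ur)//.
  suff -> : u = p by rewrite subrr.
  by apply/colP => k; have := bu k; rewrite b0 !mxE; lra.
exists (\col_k s k) => u Uu.
have := sP (fun k => (u - p) k 0) (f u - f p).
rewrite dotvE; under [in X in _ -> X]eq_bigr do rewrite mxE.
by rewrite lerBrDl; apply; exists u.
Unshelve. all: by end_near. Qed.

Lemma lipschitz_at U f p : locally_lipschitz_on U f -> U p ->
  exists2 V, nbhs p V & \forall K \near +oo,
    forall q q', V q -> V q' -> `|f q - f q'| <= K * `|q - q'|.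
Proof.
move=> fL Up; have [V pV VL] := fL _ Up; exists V => //.
move: VL; rewrite /lipschitz_on; apply: filterS => K h q q' Vq Vq'.
exact: (h (q, q')).
Qed.

Lemma locally_lipschitz_continuous U f p :
  locally_lipschitz_on U f -> U p -> {for p, continuous f}.
Proof.
move=> fL Up; have [V pV] := lipschitz_at fL Up.
move=> /pinfty_ex_gt0[K K0 KV].
apply/(@cvgrPdist_lt R R^o _ (nbhs p)) => e e0.
near=> q.
have Vq : V q by near: q.
rewrite (le_lt_trans (KV p q _ _))//; first exact: nbhs_singleton.
rewrite mulrC -ltr_pdivlMr//; near: q.
by apply: cvgr_dist_lt => //; rewrite divr_gt0.
Unshelve. all: by end_near. Qed.

(** A Lipschitz constant bounds every difference quotient near p, hence their
    upper limit. *)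
Lemma clarke_le f V p v g (K : R) : nbhs p V ->
  (forall q q', V q -> V q' -> `|f q - f q'| <= K * `|q - q'|) ->
  clarke_gradient f p g -> dotv g v <= K * `|v|.
Proof.
move=> pV VK /(_ v) gp; rewrite -lee_fin (le_trans gp)//.
rewrite /clarke_dirderiv limf_esupE.
pose W := [set qt : 'cV[R]_n * R | [/\ V qt.1, V (qt.1 + qt.2 *: v) & 0 < qt.2]].
apply: (@le_trans _ _ (ereal_sup ((fun qt : 'cV[R]_n * R =>
   ((f (qt.1 + qt.2 *: v) - f qt.1) / qt.2)%:E) @` W))).
  apply: ereal_inf_lbound; exists W => //.
  have c : (qt.1 + qt.2 *: v) @[qt --> filter_prod (nbhs p) (0:R)^'+] --> p.
    rewrite -[X in _ --> X]addr0 -(scale0r v); apply: cvgD; first exact: cvg_fst.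
    apply: cvgZr_tmp; apply: (@cvg_trans _ (0:R)^'+); first exact: cvg_snd.
    exact: cvg_at_right_filter.
  have t0 : filter_prod (nbhs p) (0 : R)^'+ [set qt | 0 < qt.2].
    exists (setT, [set t | 0 < t]) => [|qt []//].
    by split => /=; [exact: filterT|exact: nbhs_right_gt].
  near=> qt; split.
  - by near: qt; exact: cvg_fst.
  - by near: qt; exact: c.
  - by near: qt; exact: t0.
apply: ge_ereal_sup => _ [[q t] [/= Vq Vqt t0] <-].
rewrite lee_fin ler_pdivrMr// (le_trans (ler_norm _))//.
rewrite (le_trans (VK _ _ Vqt Vq))// (addrC q) addrK normrZ gtr0_norm//.
by rewrite mulrAC mulrA.
Unshelve. all: by end_near. Qed.

(** Local Lipschitz constants bound the gradients near each point; compactness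
    makes the bound uniform. *)
Lemma clarke_bounded U f (S : set 'cV[R]_n) : locally_lipschitz_on U f ->
  compact S -> S `<=` U -> exists2 G : R, 0 < G & forall p, S p ->
    forall g, clarke_gradient f p g -> forall k, `|g k 0| <= G.
Proof.
move=> fL cS SU.
have : \forall K \near +oo, S `<=` [set p | forall g, clarke_gradient f p g ->
    forall k, `|g k 0| <= (K : R)].
  apply: (proj1 (compact_near_coveringP S) cS) => p /SU Up.
  have [V pV KV] := lipschitz_at fL Up.
  exists ([set q | nbhs q V], [set K | 0 < K /\ forall q q', V q -> V q' -> `|f q - f q'| <= K * `|q - q'|]).
    split => /=; first exact: nbhs_interior.
    by near=> K; split; near: K => //; exact: nbhs_pinfty_gt.
  move=> [q K] [/= qV [K0 {}KV]] g gq k.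
  have e1 : `|delta_mx k 0 : 'cV[R]_n| <= 1.
    by apply: mx_norm_ler => // i j; rewrite mxE; case: (_ && _); rewrite ?normr1 ?normr0.
  have dk : dotv g (delta_mx k 0) = g k 0.
    rewrite dotvE (bigD1 k)//= big1 ?addr0 ?mxE ?eqxx ?mulr1// => j jk.
    by rewrite mxE (negbTE jk) mulr0.
  have le1 : K * `|delta_mx k 0 : 'cV[R]_n| <= K by rewrite ger_pMr.
  rewrite ler_norml; apply/andP; split.
    have := clarke_le (- delta_mx k 0) qV KV gq.
    rewrite dotvNr dk normrN; lra.
  have := clarke_le (delta_mx k 0) qV KV gq.
  by rewrite dk; lra.
move=> /pinfty_ex_gt0[G G0 GS]; exists G.
Unshelve. all: by end_near. Qed.

End dirderiv.

(** * Optimality conditions of the resource allocation problem *)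

(** Strong monotonicity is only used between p and the midpoint m of p and z.
    Adding the subgradient inequality at p towards m to the one at m towards z
    gives the quadratic term with the constant omega / 4, without integrating
    along the segment. *)
Lemma strong_growth (R : realType) (n : nat) (U C : set 'cV[R]_n)
    (f : 'cV[R]_n -> R) (omega : R) p z g :
  open U -> convex_set U -> convex_function U f ->
  convex_set C -> C `<=` U -> strongly_convex_on omega C f ->
  C p -> C z -> subgradient U f p g ->
  f p + dotv g (z - p) + omega / 4 * dotv (z - p) (z - p) <= f z.
Proof.
move=> oU cU cf cC CU sf Cp Cz gp.
pose m := 2^-1 *: z + (1 - 2^-1) *: p.
have Cm : C m by apply: convex_setE => //; lra.
have [gm gmP] := subgradient_exists oU cU cf (CU _ Cm).
have h1 := gmP _ (CU _ Cz); have h2 := gp _ (CU _ Cm).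
have cl q h : C q -> subgradient U f q h -> clarke_gradient f q h.
  by move=> Cq; apply: subgradient_clarke; apply: open_nbhs_nbhs; split => //; exact: CU.
have := sf _ _ _ _ Cm Cp (cl _ _ Cm gmP) (cl _ _ Cp gp).
have mp : m - p = 2^-1 *: (z - p) by apply/colP => k; rewrite !mxE; lra.
have zm : z - m = 2^-1 *: (z - p) by apply/colP => k; rewrite !mxE; lra.
rewrite enorm_sqr; move: h1 h2; rewrite mp zm !dotvZl !dotvZr.
rewrite (dotvBr gm g) (dotvC _ gm) (dotvC _ g); lra.
Qed.

Section resource_allocation.
Variables (R : realType) (N n : nat).
Variables (f : 'I_N -> 'cV[R]_n -> R) (Omega U : 'I_N -> set 'cV[R]_n).
Variable d : 'I_N -> 'cV[R]_n.
Hypothesis Omega_convex : forall i, convex_set (Omega i).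
Hypothesis U_open : forall i, open (U i).
Hypothesis U_convex : forall i, convex_set (U i).
Hypothesis Omega_sub_U : forall i, Omega i `<=` U i.
Hypothesis f_convex : forall i, convex_function (U i) (f i).
Hypothesis slater_cond : slater Omega d.

(** The points p + t (p - z) are affine combinations of p and z, and they are
    close to p for small t. *)
Lemma relative_interior_ray (C : set 'cV[R]_n) p z :
  relative_interior C p -> C z -> \forall t \near (0 : R)^'+, C (p + t *: (p - z)).
Proof.
move=> [Cp pC] Cz.
have := near_ray (p - z) pC; apply: filterS => t; apply.
exists 2%N, (fun k : 'I_2 => if k == 0 then 1 + t else - t),
  (fun k : 'I_2 => if k == 0 then p else z); split.
- by move=> k; case: ifP.
- by rewrite !big_ord_recl big_ord0 /=; lra.
- rewrite !big_ord_recl big_ord0 /= addr0.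
  by apply/colP => k; rewrite !mxE; ring.
Qed.

(** The constraint sum is perturbed together with the points at which the
    objective is evaluated: the points u_i of U_i may differ from the points
    z_i of Omega_i. The set of triples made of u - z, of the constraint
    violation of z and of an upper bound of the objective gap at u is convex,
    and above the origin it lies over feasible points, where optimality
    applies. Slater's point allows every such perturbation to be reversed. The
    minorant delivers gradients and multiplier together, which avoids a sum
    rule for the subdifferentials of the objective and of the indicator
    functions. *)
Lemma lagrangian_subgradient y : optimal f Omega d y ->
  exists (g : 'I_N -> 'cV[R]_n) (s : 'cV[R]_n), forall u z,
    (forall i, U i (u i)) -> (forall i, Omega i (z i)) ->
    \sum_i dotv (g i) (u i - z i) + dotv s (\sum_i (z i - d i)) <=
    \sum_i f i (u i) - \sum_i f i (y i).
Proof.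
move=> [[ysum yO] ymin].
pose C (b : 'I_N * 'I_n + 'I_n -> R) (r : R) :=
  exists u z, [/\ (forall i, U i (u i)) /\ (forall i, Omega i (z i)),
    forall i k, b (inl (i, k)) = (u i - z i) k 0,
    forall k, b (inr k) = (\sum_i (z i - d i)) k 0 &
    \sum_i f i (u i) - \sum_i f i (y i) <= r].
have [|||s sP] := @linear_minorant R _ C.
- move=> b r b' r' t t0 t1 [u [z [[Uu Oz] b1 b2 ur]]] [u' [z' [[Uu' Oz'] b1' b2' ur']]].
  exists (fun i => t *: u i + (1 - t) *: u' i), (fun i => t *: z i + (1 - t) *: z' i).
  split.
  + by split=> i; apply: convex_setE => //; exact: ltW.
  + by move=> i k; rewrite b1 b1' !mxE; ring.
  + move=> k; rewrite b2 b2' !summxE !mulr_sumr -big_split/=.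
    by apply: eq_bigr => i _; rewrite !mxE; ring.
  + have : \sum_i f i (t *: u i + (1 - t) *: u' i) <=
        t * \sum_i f i (u i) + (1 - t) * \sum_i f i (u' i).
      rewrite !mulr_sumr -big_split/=; apply: ler_sum => i _.
      by apply: convex_functionE (@f_convex i) _ _ _ _ => //; exact: ltW.
    have : t * (\sum_i f i (u i) - \sum_i f i (y i)) <= t * r by rewrite ler_pM2l.
    have : (1 - t) * (\sum_i f i (u' i) - \sum_i f i (y i)) <= (1 - t) * r'.
      by rewrite ler_pM2l// subr_gt0.
    lra.
- move=> b r [u [z [[Uu Oz] b1 b2 ur]]].
  have [zb [zbO zbsum]] := slater_cond.
  have nU : \forall t \near (0 : R)^'+, forall i,
      U i (zb i + t *: ((zb i - z i) - (u i - z i))).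
    apply: filter_forall => j; apply: near_ray.
    by apply: open_nbhs_nbhs; split => //; apply: Omega_sub_U; case: (zbO j).
  have nO : \forall t \near (0 : R)^'+, forall i, Omega i (zb i + t *: (zb i - z i)).
    by apply: filter_forall => j; exact: relative_interior_ray.
  near (0 : R)^'+ => t.
  have Ut : forall i, U i (zb i + t *: ((zb i - z i) - (u i - z i))) by near: t.
  have Ot : forall i, Omega i (zb i + t *: (zb i - z i)) by near: t.
  exists t => //.
  (* From Slater's point, step against the perturbation of the given point. *)
  pose z' i := zb i + t *: (zb i - z i).
  pose u' i := zb i + t *: ((zb i - z i) - (u i - z i)).
  exists (\sum_i f i (u' i) - \sum_i f i (y i)), u', z'; split => //.
  + by move=> i k; rewrite b1 !mxE; ring.
  + move=> k; rewrite b2.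
    have -> : \sum_i (z' i - d i) = - t *: \sum_i (z i - d i).
      rewrite /z' !sumrB !big_split/= -scaler_sumr sumrB zbsum.
      by apply/colP => j; rewrite !mxE; ring.
    by rewrite mxE.
- move=> b r [u [z [[Uu Oz] b1 b2 ur]]] b0; rewrite (le_trans _ ur)// subr_ge0.
  have -> : u = z.
    apply/funext => i; apply/colP => k; have := b1 i k.
    by rewrite b0 !mxE; lra.
  apply: ymin; split => //; apply/eqP; rewrite -subr_eq0 -sumrB; apply/eqP.
  by apply/colP => k; rewrite -b2 b0 mxE.
exists (fun i => \col_k s (inl (i, k))), (\col_k s (inr k)) => u z Uu Oz.
pose b (x : 'I_N * 'I_n + 'I_n) := match x with
  | inl ik => (u ik.1 - z ik.1) ik.2 0
  | inr k => (\sum_i (z i - d i)) k 0 end.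
have := sP b (\sum_i f i (u i) - \sum_i f i (y i)).
rewrite big_sumType/= => h; rewrite (le_trans _ (h _))//; last by exists u, z.
rewrite dotvE; under [X in _ + X <= _]eq_bigr do rewrite mxE.
rewrite lerD2r [leRHS](_ : _ = \sum_i \sum_k s (inl (i, k)) * (u i - z i) k 0);
  last by rewrite pair_bigA; apply: eq_bigr => -[].
apply: ler_sum => i _; rewrite dotvE.
by apply: ler_sum => k _; rewrite mxE.
Unshelve. all: by end_near. Qed.

(** All components but one are kept at y in the previous inequality; z = y_i
    then gives the subgradient inequality, and u = y_i the normality of s -
    g_i. *)
Lemma kkt y : optimal f Omega d y ->
  exists (g : 'I_N -> 'cV[R]_n) (s : 'cV[R]_n), forall i,
    subgradient (U i) (f i) (y i) (g i) /\
    forall z, Omega i z -> dotv (s - g i) (z - y i) <= 0.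
Proof.
move=> yopt; have [g [s gsP]] := lagrangian_subgradient yopt.
have [[ysum yO] ymin] := yopt.
exists g, s => i.
have gsi u z : U i u -> Omega i z ->
    dotv (g i) (u - z) + dotv s (z - y i) <= f i u - f i (y i).
  move=> Uu Oz; pose ext (v : 'cV[R]_n) j := if j == i then v else y j.
  have ext_i v : ext v i = v by rewrite /ext eqxx.
  have ext_j v j : j != i -> ext v j = y j by rewrite /ext => /negbTE ->.
  have := gsP (ext u) (ext z).
  have -> : \sum_j dotv (g j) (ext u j - ext z j) = dotv (g i) (u - z).
    rewrite (bigD1 i)//= big1 ?addr0 ?ext_i// => j ji.
    by rewrite !ext_j// subrr dotv0.
  have -> : \sum_j (ext z j - d j) = z - y i.
    rewrite sumrB -ysum -sumrB (bigD1 i)//= big1 ?addr0 ?ext_i// => j ji.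
    by rewrite ext_j// subrr.
  have -> : \sum_j f j (ext u j) - \sum_j f j (y j) = f i u - f i (y i).
    rewrite -sumrB (bigD1 i)//= big1 ?addr0 ?ext_i// => j ji.
    by rewrite ext_j// subrr.
  apply => j; have [->|ji] := eqVneq j i; rewrite ?ext_i ?ext_j//.
  exact: Omega_sub_U.
split.
  move=> u Uu; have := gsi u (y i) Uu (yO i).
  by rewrite subrr dotv0; lra.
move=> z Oz; have := gsi (y i) z (Omega_sub_U (yO i)) Oz.
by rewrite subrr -opprB dotvNr dotvBl; lra.
Qed.

Hypothesis Omega_closed : forall i, closed (Omega i).
Hypothesis f_loc_lipschitz : forall i, locally_lipschitz_on (U i) (f i).
Variable omega : R.
Hypothesis omega_gt0 : 0 < omega.
Hypothesis f_strongly_convex : forall i, strongly_convex_on omega (Omega i) (f i).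

(** The multiplier term vanishes on feasible points, so the quadratic growth
    of each f_i adds up to quadratic growth of the objective around y. *)
Lemma optimal_unique y z : optimal f Omega d y -> optimal f Omega d z -> z = y.
Proof.
move=> yopt zopt; have [g [s gsP]] := kkt yopt.
have [[ysum yO] ymin] := yopt; have [[zsum zO] zmin] := zopt.
have := zmin _ (proj1 yopt).
have gr i : f i (y i) + dotv s (z i - y i) +
    omega / 4 * dotv (z i - y i) (z i - y i) <= f i (z i).
  have [gi si] := gsP i.
  have := strong_growth (@U_open i) (@U_convex i) (@f_convex i) (@Omega_convex i)
    (@Omega_sub_U i) (@f_strongly_convex i) (yO i) (zO i) gi.
  by have := si _ (zO i); rewrite dotvBl; lra.
have : \sum_i (f i (y i) + dotv s (z i - y i) +
    omega / 4 * dotv (z i - y i) (z i - y i)) <= \sum_i f i (z i).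
  by apply: ler_sum => i _; exact: gr.
rewrite !big_split/= -dotv_sumr sumrB zsum ysum subrr dotv0 -mulr_sumr => h1 h2.
have S0 : \sum_i dotv (z i - y i) (z i - y i) = 0.
  apply/eqP; rewrite eq_le sumr_ge0 ?andbT; last by move=> *; exact: dotv_ge0.
  have : omega / 4 * \sum_i dotv (z i - y i) (z i - y i) <= 0 by lra.
  by rewrite pmulr_rle0// divr_gt0.
apply/funext => i; apply/eqP; rewrite -subr_eq0 -dotv_eq0; apply/eqP.
by apply: (psumr_eq0P _ S0) => // j _; exact: dotv_ge0.
Qed.

Lemma continuous_col (i : 'I_N) : continuous (fun M : 'M[R]_(n, N) => col i M).
Proof.
apply: continuous_mx => k j; under eq_fun do rewrite mxE.
exact: coord_continuous.
Qed.

Lemma continuous_sum (T : topologicalType) (V : normedModType R) (I : Type)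
    (r : seq I) (F : I -> T -> V) x :
  (forall i, F i y @[y --> x] --> F i x) ->
  \sum_(i <- r) F i y @[y --> x] --> \sum_(i <- r) F i x.
Proof.
move=> Fc; elim: r => [|i r ih].
  by rewrite big_nil; under eq_fun do rewrite big_nil; exact: cvg_cst.
by rewrite big_cons; under eq_fun do rewrite big_cons; exact: cvgD.
Qed.

(** Quadratic growth from a Slater point zb confines the feasible points that
    are at least as good as zb to a ball, so the minimum may be sought in a
    compact set. *)
Lemma optimal_exists : exists y, optimal f Omega d y.
Proof.
have [zb [zbO zbsum]] := slater_cond.
have {}zbO i : Omega i (zb i) by case: (zbO i).
have zU i : U i (zb i) by exact: Omega_sub_U.
have /choice[g gP] : forall i, exists g, subgradient (U i) (f i) (zb i) g.
  by move=> i; exact: subgradient_exists.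
pose q (y : 'I_N -> 'cV[R]_n) := \sum_i dotv (y i - zb i) (y i - zb i).
(* From the growth inequality, with Young's inequality at weight omega / 8 on
   its linear term. *)
pose B := 16 / omega ^+ 2 * \sum_i dotv (g i) (g i).
have qB y : (forall i, Omega i (y i)) ->
    \sum_i f i (y i) <= \sum_i f i (zb i) -> q y <= B.
  move=> yO yle.
  have gr i : f i (zb i) - 2 / omega * dotv (g i) (g i) +
      omega / 8 * dotv (y i - zb i) (y i - zb i) <= f i (y i).
    have := strong_growth (@U_open i) (@U_convex i) (@f_convex i) (@Omega_convex i)
      (@Omega_sub_U i) (@f_strongly_convex i) (zbO i) (yO i) (gP i).
    have o8 : 0 < omega / 8 by rewrite divr_gt0.
    have := young_dotv (y i - zb i) (- g i) o8.
    rewrite dotvNr (dotvC _ (g i)) dotvNr dotvNl opprK.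
    have -> : (4 * (omega / 8))^-1 = 2 / omega by field; rewrite gt_eqF.
    lra.
  have : \sum_i (f i (zb i) - 2 / omega * dotv (g i) (g i) +
      omega / 8 * dotv (y i - zb i) (y i - zb i)) <= \sum_i f i (y i).
    by apply: ler_sum => i _; exact: gr.
  rewrite !big_split/= -!mulr_sumr sumrN -mulr_sumr -/(q y) => h.
  have {}h : omega / 8 * q y <= 2 / omega * \sum_i dotv (g i) (g i) by lra.
  rewrite -(@ler_pM2l _ (omega / 8)); last by rewrite divr_gt0.
  apply: le_trans h _; rewrite /B le_eqVlt; apply/orP; left; apply/eqP.
  by field; rewrite gt_eqF.
pose K := [set M : 'M[R]_(n, N) | [/\ forall i, Omega i (col i M),
  \sum_i col i M = \sum_i d i & q (fun i => col i M) <= B]].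
pose Mz := \matrix_(k, i) zb i k 0.
have colMz i : col i Mz = zb i by apply/colP => k; rewrite !mxE.
have B0 : 0 <= B.
  rewrite mulr_ge0// ?divr_ge0 ?sqr_ge0//.
  by apply: sumr_ge0 => i _; exact: dotv_ge0.
have K0 : K !=set0.
  exists Mz; split.
  - by move=> i; rewrite colMz.
  - by under eq_bigr do rewrite colMz.
  - rewrite /q big1// => i _; rewrite colMz subrr dotv0//.
have cq : continuous (fun M : 'M[R]_(n, N) => q (fun i => col i M)).
  move=> M; apply: continuous_sum => i.
  under eq_fun do rewrite dotvE; rewrite dotvE.
  apply: continuous_sum => k.
  have ck : (col i M' - zb i) k 0 @[M' --> M] --> (col i M - zb i) k 0.
    under eq_fun do rewrite !mxE; rewrite !mxE.
    apply: (@cvgB _ _ _ (nbhs M)); last exact: cvg_cst.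
    exact: (@coord_continuous R n N k i M).
  exact: (@cvgM _ _ (nbhs M)).
have cs : continuous (fun M : 'M[R]_(n, N) => \sum_i col i M).
  by move=> M; apply: continuous_sum => i; exact: continuous_col.
have clK : closed K.
  have -> : K = (\bigcap_i ((fun M => col i M) @^-1` Omega i)) `&`
      ((fun M : 'M[R]_(n, N) => \sum_i col i M) @^-1` [set \sum_i d i]) `&`
      ((fun M : 'M[R]_(n, N) => q (fun i => col i M)) @^-1` [set r | r <= B]).
    apply/seteqP; split=> [M [h1 h2 h3]|M [[h1 h2] h3]]; last by split => // i; apply: h1.
    by split; first split; [move=> i _; exact: h1|exact: h2|exact: h3].
  apply: closedI; first apply: closedI.
  - by apply: closed_bigI => i _; apply: preimage_closed => // M _; exact: continuous_col.
  - apply: preimage_closed => [M _|]; first exact: cs.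
    by apply: accessible_closed_set1; apply: hausdorff_accessible; exact: norm_hausdorff.
  - by apply: preimage_closed => [M _|]; [exact: cq|exact: closed_le].
have cK : compact K.
  apply: (@mx_bounded_closed_compact _ _ _ _ (\sum_i `|zb i| + (1 + B))) clK.
  move=> M [_ _ qMB] k i.
  have c1 : (col i M - zb i) k 0 ^+ 2 <= B.
    rewrite (le_trans (sqr_coord_le _ _))// (le_trans _ qMB)// /q (bigD1 i)//= lerDl.
    by apply: sumr_ge0 => j _; exact: dotv_ge0.
  have c2 : `|M k i - zb i k 0| <= 1 + B.
    by move: c1; rewrite !mxE; exact: sqr_le_normD1.
  have c3 : `|zb i k 0| <= \sum_i `|zb i|.
    by rewrite (le_trans (ler_mx_norm _ _ _))// (bigD1 i)//= lerDl sumr_ge0.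
  rewrite -(subrK (zb i k 0) (M k i)) (le_trans (ler_normD _ _))// addrC.
  exact: lerD.
have cF : {within K, continuous (fun M => \sum_i f i (col i M))}.
  apply: continuous_in_subspaceT => M; rewrite inE => -[MO _ _].
  apply: continuous_sum => i.
  apply: (@cvg_comp _ _ _ (col i) (f i)); first exact: continuous_col.
  exact: (locally_lipschitz_continuous (@f_loc_lipschitz i) (Omega_sub_U (MO i))).
have [M /set_mem[MO Msum MB] Mmin] := compact_EVT_min K0 cK cF.
exists (fun i => col i M); split; first by split.
move=> z [zsum zO].
have zle : \sum_i f i (col i M) <= \sum_i f i (zb i).
  have := Mmin Mz; rewrite inE /=; 
  rewrite (eq_bigr (fun i => f i (zb i)) (fun i _ => congr1 (f i) (colMz i))).
  apply; split => [i||]; first by rewrite colMz.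
  + by under eq_bigr do rewrite colMz.
  + by rewrite /q big1// => i _; rewrite colMz subrr dotv0.
have [zz|zz] := leP (\sum_i f i (z i)) (\sum_i f i (zb i)); last exact: le_trans zle (ltW zz).
pose M' := \matrix_(k, i) z i k 0.
have colM' i : col i M' = z i by apply/colP => k; rewrite !mxE.
have := Mmin M'; rewrite inE /=; 
  rewrite (eq_bigr (fun i => f i (z i)) (fun i _ => congr1 (f i) (colM' i))).
apply; split => [i||]; first by rewrite colM'.
- by under eq_bigr do rewrite colM'.
- have -> : (fun i => col i M') = z by apply/funext => i; exact: colM'.
  exact: qB.
Qed.

End resource_allocation.

(** * Euclidean projections *)

(** Letting t tend to 0 would do; a single t, for which t b <= a, already
    gives a contradiction when a > 0. *)
Lemma quadratic_tangent (R : realType) (a b : R) : 0 <= b ->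
  (forall t, 0 < t -> t <= 1 -> 2 * t * a <= t ^+ 2 * b) -> a <= 0.
Proof.
move=> b0 H; rewrite leNgt; apply/negP => a0.
have ab : 0 < a + b by lra.
have [t [t0 t1 E]] : exists t, [/\ 0 < t, t <= 1 & t * (a + b) = a].
  exists (a / (a + b)); split; first by rewrite divr_gt0.
    by rewrite ler_pdivrMr// mul1r lerDl.
  by rewrite divfK// gt_eqF.
have := H _ t0 t1; rewrite expr2 (mulrC 2) -!mulrA ler_pM2l// => h.
have := mulr_gt0 t0 a0; lra.
Qed.

Lemma dotv_line (R : realType) n (u v : 'cV[R]_n) t :
  dotv (u + t *: v) (u + t *: v) =
  dotv u u + 2 * t * dotv u v + t ^+ 2 * dotv v v.
Proof. by rewrite !dotvL (dotvC v u); ring. Qed.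

Lemma continuous_dotv (R : realType) (T : topologicalType) n
    (g h : T -> 'cV[R]_n) : continuous g -> continuous h ->
  continuous (fun x => dotv (g x) (h x)).
Proof.
move=> gc hc x; under eq_fun do rewrite dotvE.
apply: continuous_sum => k.
apply: (@cvgM _ _ (nbhs x)).
  apply: (@cvg_comp _ _ _ g (fun M : 'cV[R]_n => M k 0)); first exact: gc.
  exact: coord_continuous.
apply: (@cvg_comp _ _ _ h (fun M : 'cV[R]_n => M k 0)); first exact: hc.
exact: coord_continuous.
Qed.

Lemma compact_dotv_le (R : realType) n (C : set 'cV[R]_n) p (r : R) :
  closed C -> compact (C `&` [set z | dotv (p - z) (p - z) <= r]).
Proof.
move=> clC; apply: (@mx_bounded_closed_compact _ _ _ _ (`|p| + (1 + r))).
  move=> z [_ /= zr] k j; rewrite ord1.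
  have c1 : (p - z) k 0 ^+ 2 <= r by rewrite (le_trans (sqr_coord_le _ _)).
  have c2 : `|z k 0 - p k 0| <= 1 + r.
    by move: c1; rewrite !mxE distrC; exact: sqr_le_normD1.
  rewrite -(subrK (p k 0) (z k 0)) (le_trans (ler_normD _ _))// addrC.
  by apply: lerD => //; exact: ler_mx_norm.
apply: closedI => //.
have c : continuous (fun z : 'cV[R]_n => dotv (p - z) (p - z)).
  by apply: continuous_dotv => z; apply: (@cvgB _ _ _ (nbhs z));
    [exact: cvg_cst|exact: cvg_id|exact: cvg_cst|exact: cvg_id].
by apply: (@preimage_closed _ _ (fun z : 'cV[R]_n => dotv (p - z) (p - z)) [set x | x <= r]) => [z _|];
  [exact: c|exact: closed_le].
Qed.

Section projection.
Variables (R : realType) (n : nat) (C : set 'cV[R]_n).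
Hypotheses (C_closed : closed C) (C_convex : convex_set C) (C0 : C !=set0).
Implicit Types p q y z : 'cV[R]_n.

Lemma projP p : argmin_dist C p (proj C p).
Proof.
apply: xgetPex; have [z0 Cz0] := C0.
pose D := fun z => dotv (p - z) (p - z).
pose K := C `&` [set z | D z <= D z0].
have cD : continuous D.
  by apply: continuous_dotv => z; apply: (@cvgB _ _ _ (nbhs z));
    [exact: cvg_cst|exact: cvg_id|exact: cvg_cst|exact: cvg_id].
have K0 : K !=set0 by exists z0; split => //=.
have [q /set_mem[Cq qz0] qmin] :=
  compact_EVT_min K0 (@compact_dotv_le R n C p (D z0) C_closed) (continuous_subspaceT cD).
exists q; split => // z Cz; rewrite enorm_le.
have [zz0|/ltW zz0] := leP (D z) (D z0); first by apply: qmin; rewrite inE.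
exact: le_trans zz0.
Qed.

Lemma proj_in p : C (proj C p). Proof. by case: (projP p). Qed.

Lemma proj_min p z : C z ->
  dotv (p - proj C p) (p - proj C p) <= dotv (p - z) (p - z).
Proof. by move=> Cz; rewrite -enorm_le; case: (projP p) => _; exact. Qed.

(** Moving from the projection towards z must not decrease the distance to p,
    to first order in the step. *)
Lemma proj_variational p z : C z -> dotv (p - proj C p) (z - proj C p) <= 0.
Proof.
move=> Cz; have := proj_in p; have := @proj_min p; set P := proj C p => Pmin CP.
apply: (quadratic_tangent (dotv_ge0 (z - P))) => t t0 t1.
have /Pmin := convex_setE C_convex (ltW t0) t1 Cz CP.
have -> : p - (t *: z + (1 - t) *: P) = (p - P) + (- t) *: (z - P).
  by apply/colP => k; rewrite !mxE; ring.
by rewrite dotv_line sqrrN; lra.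
Qed.

Lemma proj_monotone p q : dotv (proj C q - proj C p) (proj C q - proj C p) <=
  dotv (proj C q - proj C p) (q - p).
Proof.
have := proj_variational p (proj_in q); have := proj_variational q (proj_in p).
move: (proj C p) (proj C q) => a b.
by rewrite !dotvL !(dotvC b) !(dotvC a); lra.
Qed.

Lemma proj_cross p q : dotv (proj C q - proj C p) (q - p) <= dotv (q - p) (q - p).
Proof.
have := proj_monotone p q.
have := dotv_ge0 ((q - p) + (- 1) *: (proj C q - proj C p)).
move: (proj C p) (proj C q) => a b.
by rewrite dotv_line (dotvC (q - p) (b - a)); lra.
Qed.

Lemma proj_nonexpansive p q : dotv (proj C q - proj C p) (proj C q - proj C p) <=
  dotv (q - p) (q - p).
Proof. exact: le_trans (proj_monotone p q) (proj_cross p q). Qed.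

(** The primal part of the Lyapunov function. As minus the squared distance to
    C is a supremum of concave parabolas in p, this is a supremum of affine
    functions of p, one for each point of C, attained at the projection of p. *)
Definition proj_gap y p :=
  2^-1 * (dotv (p - y) (p - y) - dotv (p - proj C p) (p - proj C p)).

Lemma proj_gap_ge y p : C y ->
  2^-1 * dotv (proj C p - y) (proj C p - y) <= proj_gap y p.
Proof.
move=> Cy; have := proj_variational p Cy; rewrite /proj_gap.
move: (proj C p) => a; have -> : p - y = (p - a) + 1 *: (a - y).
  by apply/colP => k; rewrite !mxE; ring.
by rewrite dotv_line -(opprB a y) dotvNr; lra.
Qed.

(** The affine function attached to the projection of p is exact at p and
    below the supremum at q. *)
Lemma proj_gap_lb y p q :
  dotv (proj C p - y) (q - p) <= proj_gap y q - proj_gap y p.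
Proof.
have := proj_min q (proj_in p); rewrite /proj_gap.
move: (proj C p) (proj C q) => a b h.
suff : dotv (a - y) (q - p) =
    2^-1 * (dotv (q - y) (q - y) - dotv (q - a) (q - a)) -
    2^-1 * (dotv (p - y) (p - y) - dotv (p - a) (p - a)) by lra.
by rewrite !dotvL !(dotvC y) !(dotvC a); lra.
Qed.

Lemma proj_gap_ub y p q :
  proj_gap y q - proj_gap y p <= dotv (proj C q - y) (q - p).
Proof.
have := proj_gap_lb y q p; rewrite -(opprB q p) dotvNr.
by rewrite lerNl opprB.
Qed.

(** The two affine bounds differ by the inner product of the increments of the
    projection and of the point. Hence the gap is differentiable everywhere,
    with gradient proj C p - y, although the projection itself need not be. *)
Lemma proj_gap_expansion y p q :
  `|proj_gap y q - proj_gap y p - dotv (proj C p - y) (q - p)| <=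
  dotv (q - p) (q - p).
Proof.
have := proj_gap_lb y p q; have := proj_gap_ub y p q; have := proj_cross p q.
move: (proj_gap y p) (proj_gap y q) (proj C p) (proj C q) => gp gq a b.
have := dotv_ge0 (q - p); rewrite (dotvBl b a) (dotvBl a y) (dotvBl b y).
by move=> h0 h1 h2 h3; rewrite ler_norml; apply/andP; split; lra.
Qed.

End projection.

(** * Laplacians of balanced digraphs *)

Section laplacian.
Variables (R : realType) (N : nat) (A : 'M[R]_N).
Hypothesis A_ge0 : forall i j, 0 <= A i j.
Hypothesis A_balanced : weight_balanced A.
Implicit Types u v w : 'cV[R]_N.
Let L := laplacian A.

Lemma laplacianE v i : (L *m v) i 0 = \sum_j A i j * (v i 0 - v j 0).
Proof.
rewrite /L /laplacian mulmxBl mul_diag_mx !mxE mulr_suml -sumrB.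
by apply: eq_bigr => j _; ring.
Qed.

Lemma laplacian_sum v : \sum_i (L *m v) i 0 = 0.
Proof.
under eq_bigr do rewrite laplacianE.
under eq_bigr do (under eq_bigr do rewrite mulrBr; rewrite sumrB -mulr_suml A_balanced).
rewrite sumrB (exchange_big _ _ _ _ _ (fun i j => A i j * v j 0)) -sumrB/=.
by rewrite big1// => i _; rewrite mulr_suml subrr.
Qed.

(** Weight balance makes the row and column sums of A interchangeable, so the
    quadratic form only sees the differences along arcs. *)
Lemma laplacian_quad v :
  dotv v (L *m v) = 2^-1 * \sum_i \sum_j A i j * (v i 0 - v j 0) ^+ 2.
Proof.
have h : \sum_i \sum_j A i j * v i 0 ^+ 2 = \sum_i \sum_j A i j * v j 0 ^+ 2.
  rewrite [RHS]exchange_big/=; apply: eq_bigr => i _.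
  by rewrite -!mulr_suml A_balanced.
have -> : \sum_i \sum_j A i j * (v i 0 - v j 0) ^+ 2 =
    \sum_i \sum_j A i j * v i 0 ^+ 2 + \sum_i \sum_j A i j * v j 0 ^+ 2 -
    2 * \sum_i \sum_j A i j * (v i 0 * v j 0).
  rewrite mulr_sumr -big_split -sumrB/=; apply: eq_bigr => i _.
  rewrite mulr_sumr -big_split -sumrB/=; apply: eq_bigr => j _; ring.
rewrite -h dotvE.
have -> : \sum_i v i 0 * (L *m v) i 0 =
    \sum_i \sum_j A i j * v i 0 ^+ 2 - \sum_i \sum_j A i j * (v i 0 * v j 0).
  rewrite -sumrB; apply: eq_bigr => i _; rewrite laplacianE mulr_sumr -sumrB.
  by apply: eq_bigr => j _; ring.
lra.
Qed.

Lemma laplacian_psd v : 0 <= dotv v (L *m v).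
Proof.
rewrite laplacian_quad mulr_ge0//; apply: sumr_ge0 => i _.
by apply: sumr_ge0 => j _; rewrite mulr_ge0// sqr_ge0.
Qed.

Lemma dotv_mulmxC (B : 'M[R]_N) u v : dotv u (B *m v) = dotv (B^T *m u) v.
Proof. by rewrite /dotv trmx_mul trmxK mulmxA. Qed.

Let S := 2^-1 *: (L + L^T).

Lemma symmetric_quad v : dotv v (S *m v) = dotv v (L *m v).
Proof.
rewrite /S -scalemxAl mulmxDl dotvZr dotvDr (dotv_mulmxC L^T) trmxK.
by rewrite (dotvC (L *m v)); lra.
Qed.

Lemma symmetricC u v : dotv u (S *m v) = dotv v (S *m u).
Proof.
rewrite dotv_mulmxC dotvC; congr (dotv _ (_ *m _)).
by rewrite /S linearZ/= linearD/= trmxK addrC.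
Qed.

Lemma laplacian_const (c : R) : L *m (const_mx c : 'cV_N) = 0.
Proof.
apply/colP => i; rewrite laplacianE big1 => [|j _]; first by rewrite mxE.
by rewrite !mxE subrr mulr0.
Qed.

Lemma dotv_const (c : R) v : dotv v (const_mx c) = c * \sum_i v i 0.
Proof. by rewrite dotvE mulr_sumr; apply: eq_bigr => i _; rewrite mxE mulrC. Qed.

Lemma symmetric_sum v : \sum_i (S *m v) i 0 = 0.
Proof.
have : dotv (S *m v) (const_mx 1) = 0.
  rewrite dotvC symmetricC /S -scalemxAl mulmxDl laplacian_const add0r dotvZr.
  rewrite dotv_mulmxC trmxK dotv_const laplacian_sum; ring.
by rewrite dotv_const mul1r.
Qed.

Hypothesis A_connected : strongly_connected A.

(** A vanishing quadratic form makes v constant along arcs, and any two nodes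
    are joined by a path. *)
Lemma laplacian_ker v : dotv v (L *m v) = 0 -> forall i j, v i 0 = v j 0.
Proof.
rewrite laplacian_quad => /eqP; rewrite mulf_eq0 invr_eq0 pnatr_eq0/= => /eqP h.
have arc_eq i j : arc A i j -> v i 0 = v j 0.
  rewrite /arc/= => Aji.
  have h1 : \sum_k A j k * (v j 0 - v k 0) ^+ 2 = 0.
    apply: (psumr_eq0P _ h) => // l _.
    by apply: sumr_ge0 => k _; rewrite mulr_ge0// sqr_ge0.
  have /eqP : A j i * (v j 0 - v i 0) ^+ 2 = 0.
    by apply: (psumr_eq0P _ h1) => // k _; rewrite mulr_ge0// sqr_ge0.
  by rewrite mulf_eq0 gt_eqF//= sqrf_eq0 subr_eq0 => /eqP.
move=> i j; have /connectP[p] := A_connected i j.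
elim: p i => [i _ -> //|k p ih i /= /andP[/arc_eq -> kp] jl].
exact: ih.
Qed.

Variable lambda2 : R.
Hypothesis lambda2P : smallest_pos_eigenvalue S lambda2.

(** The Rayleigh quotient attains its minimum on the compact unit sphere of
    the hyperplane orthogonal to the constants. *)
Lemma centered_rayleigh_min : (exists2 v : 'cV[R]_N, v != 0 & \sum_i v i 0 = 0) ->
  exists v0, [/\ dotv v0 v0 = 1, \sum_i v0 i 0 = 0 &
    forall h : 'cV[R]_N, \sum_i h i 0 = 0 -> dotv v0 (L *m v0) * dotv h h <= dotv h (L *m h)].
Proof.
move=> [v v0 vsum].
have vv : 0 < dotv v v by rewrite lt_neqAle dotv_ge0 eq_sym dotv_eq0 v0.
have normalize (h : 'cV[R]_N) : \sum_i h i 0 = 0 -> 0 < dotv h h ->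
    exists c u, [/\ h = c *: u, dotv u u = 1 & \sum_i u i 0 = 0].
  move=> hsum hh; exists (enorm h), ((enorm h)^-1 *: h).
  have e0 : enorm h != 0 by rewrite -(sqrf_eq0 (enorm h)) enorm_sqr gt_eqF.
  split; first by rewrite scalerA divff// scale1r.
    by rewrite dotvZl dotvZr mulrA -invfM -expr2 enorm_sqr mulVf// gt_eqF.
  by under eq_bigr do rewrite mxE; rewrite -mulr_sumr hsum mulr0.
pose K := [set v : 'cV[R]_N | dotv v v = 1 /\ \sum_i v i 0 = 0].
have K0 : K !=set0 by have [c [u [_ u1 u0]]] := normalize _ vsum vv; exists u.
have cid : continuous (@id 'cV[R]_N) by move=> x; exact: cvg_id.
have cS : continuous (fun v : 'cV[R]_N => \sum_i v i 0).
  by move=> x; apply: continuous_sum => i; exact: coord_continuous.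
have clK : closed K.
  have -> : K = ((fun v : 'cV[R]_N => dotv v v) @^-1` [set 1]) `&`
    ((fun v : 'cV[R]_N => \sum_i v i 0) @^-1` [set 0]) by [].
  by apply: closedI; apply: preimage_closed => [x _|];
    [exact: (continuous_dotv cid cid)|exact: closed_eq|exact: cS|exact: closed_eq].
have cK : compact K.
  apply: (@mx_bounded_closed_compact _ _ _ _ 1) clK => x [x1 _] i j; rewrite ord1.
  by apply: sqr_le_norm; rewrite // expr1n -x1 sqr_coord_le.
have cL : continuous (fun v : 'cV[R]_N => dotv v (L *m v)).
  apply: continuous_dotv => //; apply: continuous_mx => i j x.
  under eq_fun do rewrite mxE.
  apply: continuous_sum => k; apply: (@cvgM _ _ (nbhs x)); first exact: cvg_cst.
  exact: coord_continuous.
have [u /set_mem[u1 usum] umin] := compact_EVT_min K0 cK (continuous_subspaceT cL).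
exists u; split => // h hsum.
have [->|h0] := eqVneq h 0; first by rewrite mulmx0 !dotv0 mulr0.
have hh : 0 < dotv h h by rewrite lt_neqAle dotv_ge0 eq_sym dotv_eq0 h0.
have [c [x [-> x1 xsum]]] := normalize _ hsum hh.
rewrite -scalemxAr !dotvZl !dotvZr x1 mulr1 mulrC !mulrA ler_wpM2l// -?expr2 ?sqr_ge0//.
by apply: umin; rewrite inE.
Qed.

(** Courant-Fischer for the second eigenvalue. The minimizer u of the Rayleigh
    quotient among centered vectors is an eigenvector of the symmetric part of
    the Laplacian: the residual w = S u - mu u is again centered, and
    perturbing u along w gives w = 0 by first-order optimality. Its eigenvalue
    is positive because the kernel consists of the constants, hence is at
    least lambda2. *)
Lemma centered_coercive v : \sum_i v i 0 = 0 ->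
  lambda2 * dotv v v <= dotv v (L *m v).
Proof.
move=> vsum; have [->|v0] := eqVneq v 0; first by rewrite mulmx0 !dotv0 mulr0.
have [] := centered_rayleigh_min; first by exists v.
move=> u [u1 usum umin]; set mu := dotv u (L *m u) in umin.
apply: le_trans (umin _ vsum); rewrite ler_wpM2r ?dotv_ge0//.
have [l0 _ lmin] := lambda2P.
have mu_gt0 : 0 < mu.
  rewrite lt_neqAle laplacian_psd andbT eq_sym; apply/eqP => mu0.
  have uc := laplacian_ker mu0.
  have : u = 0.
    apply/colP => i; rewrite mxE.
    have : \sum_(j < N) u i 0 = 0 by rewrite -[RHS]usum; apply: eq_bigr => j _.
    rewrite sumr_const card_ord => /eqP; rewrite mulrn_eq0 => /orP[|/eqP//].
    by move=> /eqP N0; have := ltn_ord i; rewrite [X in (_ < X)%N]N0.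
  by move=> u0; move: u1; rewrite u0 dotv0 => /eqP; rewrite eq_sym oner_eq0.
apply: lmin => //; have [w wE] : exists w, w = S *m u - mu *: u by exists (S *m u - mu *: u).
have wsum : \sum_i w i 0 = 0.
  rewrite wE; under eq_bigr do rewrite mxE; rewrite big_split/= symmetric_sum add0r.
  under eq_bigr do rewrite !mxE; rewrite sumrN -mulr_sumr usum mulr0 oppr0//.
have w0 : w = 0.
  apply/eqP; rewrite -dotv_eq0 eq_le dotv_ge0 andbT.
  have Qw : 0 <= dotv w (L *m w) - mu * dotv w w by rewrite subr_ge0 umin.
  apply: (quadratic_tangent Qw) => t t0 t1.
  have : \sum_i (u + (- t) *: w) i 0 = 0.
    under eq_bigr do rewrite mxE [X in _ + X]mxE.
    by rewrite big_split/= usum add0r -mulr_sumr wsum mulr0.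
  move=> /umin; rewrite -!symmetric_quad mulmxDr -scalemxAr !dotvL.
  rewrite (symmetricC w u) symmetric_quad -/mu u1 (dotvC w u).
  have -> : dotv w w = dotv w (S *m u) - mu * dotv u w.
    by rewrite {2}wE dotvBr dotvZr (dotvC w u).
  rewrite (symmetricC w u); nra.
apply/eigenvalueP; exists u^T; last first.
  by apply/eqP => /(congr1 trmx); rewrite trmxK trmx0 => u0;
    move: u1; rewrite u0 dotv0 => /eqP; rewrite eq_sym oner_eq0.
have /eqP := w0; rewrite wE subr_eq0 => /eqP /(congr1 trmx).
by rewrite trmx_mul /S !linearZ/= linearD/= trmxK addrC => ->.
Qed.

(** The supremum that defines the spectral norm is over a bounded set, the
    rows of B bounding each coordinate of the images. *)
Lemma spectral_norm_le m n (B : 'M[R]_(m, n)) (v : 'cV[R]_n) :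
  dotv (B *m v) (B *m v) <= spectral_norm B ^+ 2 * dotv v v.
Proof.
have [->|v0] := eqVneq v 0; first by rewrite mulmx0 !dotv0 mulr0.
have vv : 0 < dotv v v by rewrite lt_neqAle dotv_ge0 eq_sym dotv_eq0 v0.
have e0 : 0 < enorm v.
  by rewrite lt_neqAle enorm_ge0 andbT eq_sym -(sqrf_eq0 (enorm v)) enorm_sqr gt_eqF.
suff : enorm (B *m ((enorm v)^-1 *: v)) <= spectral_norm B.
  move=> h; have := ler_pM (enorm_ge0 _) (enorm_ge0 _) h h.
  rewrite -!expr2 enorm_sqr -scalemxAr dotvZl dotvZr mulrA -expr2 exprVn enorm_sqr.
  by rewrite mulrC ler_pdivrMr.
apply: sup_ubound; last first.
  exists ((enorm v)^-1 *: v) => //=.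
  by rewrite -[leRHS]sqrtr1 ler_wsqrtr// dotvZl dotvZr mulrA -expr2 exprVn enorm_sqr mulVf// gt_eqF.
exists (Num.sqrt (\sum_i (\sum_j `|B i j|) ^+ 2)) => _ [u /= u1 <-].
rewrite ler_wsqrtr// dotvE; apply: ler_sum => i _.
rewrite -expr2 -real_normK ?num_real// ler_sqr ?nnegrE ?sumr_ge0// mxE.
rewrite (le_trans (ler_norm_sum _ _ _))//; apply: ler_sum => j _.
rewrite normrM ler_piMr//; apply: sqr_le_norm => //.
rewrite (le_trans (sqr_coord_le u j))// -enorm_sqr.
by rewrite ler_sqr ?nnegrE ?enorm_ge0.
Qed.

End laplacian.

(** * The dissipation inequality *)

Section dissipation.
Variables (R : realType) (N : nat) (A : 'M[R]_N) (lambda2 omega k1 k2 : R).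
Hypothesis N_gt0 : (0 < N)%N.
Hypothesis A_ge0 : forall i j, 0 <= A i j.
Hypothesis A_balanced : weight_balanced A.
Hypothesis A_connected : strongly_connected A.
Let L := laplacian A.
Hypothesis lambda2P : smallest_pos_eigenvalue (2^-1 *: (L + L^T)) lambda2.
Hypothesis omega_gt0 : 0 < omega.
Hypothesis k1_gt : spectral_norm L ^+ 2 / (lambda2 * omega) < k1.
Hypothesis k2_gt : k1 ^+ 2 / lambda2 ^+ 2 < k2.

Lemma k1_gt0 : 0 < k1.
Proof.
have [l0 _ _] := lambda2P; apply: le_lt_trans k1_gt.
by rewrite divr_ge0 ?sqr_ge0// ltW// mulr_gt0.
Qed.

(** The scalar core of the Lyapunov estimate, for one coordinate of R^n. Since
    W is centered, S may be replaced by its centered part T. Young's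
    inequality absorbs T . W into the consensus term of T at a cost of at most
    lambda2 / (4 k1) |W|^2, by the condition on k2, and W . L Y at a cost of
    lambda2 / (2 k1) |W|^2 and omega / 2 |Y|^2, by the condition on k1. Three
    quarters of the damping lambda2 / k1 |W|^2 are used up. *)
Lemma dissipation (Y S W : 'cV[R]_N) : \sum_i W i 0 = 0 ->
  - omega * dotv Y Y + dotv S W - k2 / k1 * dotv S (L *m S)
    - k1^-1 * dotv W (L *m W) + k1^-1 * dotv W (L *m Y) <=
  - (omega / 2) * dotv Y Y.
Proof.
move=> Wsum; have [l0 _ _] := lambda2P; have k10 := k1_gt0.
have k1i : 0 < k1^-1 by rewrite invr_gt0.
pose m := (\sum_i S i 0) / N%:R.
pose T := S - const_mx m.
have Tsum : \sum_i T i 0 = 0.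
  under eq_bigr do rewrite !mxE.
  rewrite big_split/= sumr_const card_ord mulNrn -mulr_natr /m divfK ?subrr//.
  by rewrite pnatr_eq0 -lt0n.
have SW : dotv S W = dotv T W.
  by rewrite dotvBl (dotvC (const_mx m)) dotv_const Wsum mulr0 subr0.
have SLS : dotv S (L *m S) = dotv T (L *m T).
  rewrite !laplacian_quad//; congr (_ * _); apply: eq_bigr => i _.
  by apply: eq_bigr => j _; rewrite !mxE; congr (_ * _ ^+ 2); ring.
rewrite SW SLS.
have k20 : 0 < k2 by apply: le_lt_trans k2_gt; rewrite divr_ge0 ?sqr_ge0.
have h1 : k2 / k1 * (lambda2 * dotv T T) <= k2 / k1 * dotv T (L *m T).
  apply: ler_wpM2l; first by rewrite divr_ge0// ltW.
  exact: (centered_coercive A_ge0 A_balanced A_connected lambda2P).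
have h2 : k1^-1 * (lambda2 * dotv W W) <= k1^-1 * dotv W (L *m W).
  apply: ler_wpM2l; first exact: ltW.
  exact: (centered_coercive A_ge0 A_balanced A_connected lambda2P).
(* This weight spends the whole consensus damping of T. *)
have c0 : 0 < k2 / k1 * lambda2 by rewrite mulr_gt0// divr_gt0.
have h3 := young_dotv T W c0.
have h4 : (4 * (k2 / k1 * lambda2))^-1 * dotv W W <= lambda2 / (4 * k1) * dotv W W.
  apply: ler_wpM2r; first exact: dotv_ge0.
  have -> : (4 * (k2 / k1 * lambda2))^-1 = k1 / (4 * (k2 * lambda2)).
    by field; rewrite !gt_eqF.
  rewrite ler_pdivrMr ?mulr_gt0//.
  have -> : lambda2 / (4 * k1) * (4 * (k2 * lambda2)) = k2 * lambda2 ^+ 2 / k1.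
    by field; rewrite gt_eqF.
  rewrite ler_pdivlMr// -expr2; apply: ltW.
  by rewrite -ltr_pdivrMr// exprn_gt0.
have c1 : 0 < lambda2 / 2 by rewrite divr_gt0.
have h5 : k1^-1 * dotv W (L *m Y) <= k1^-1 * (lambda2 / 2 * dotv W W) +
    omega / 2 * dotv Y Y.
  have := young_dotv W (L *m Y) c1; rewrite -(ler_pM2l k1i) mulrDr => h.
  apply: (le_trans h); rewrite lerD2l.
  have -> : (4 * (lambda2 / 2))^-1 = (2 * lambda2)^-1 by congr (_^-1); field.
  rewrite mulrA -invfM mulrC ler_pdivrMr ?mulr_gt0//.
  apply: le_trans (spectral_norm_le L Y) _.
  have -> : omega / 2 * dotv Y Y * (k1 * (2 * lambda2)) =
      (k1 * (lambda2 * omega)) * dotv Y Y by field.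
  apply: ler_wpM2r; first exact: dotv_ge0.
  by apply: ltW; rewrite -ltr_pdivrMr// mulr_gt0.
have h6 : k1^-1 * (lambda2 * dotv W W) = lambda2 / k1 * dotv W W by field; rewrite gt_eqF.
have h7 : k1^-1 * (lambda2 / 2 * dotv W W) = 2^-1 * (lambda2 / k1 * dotv W W).
  by field; rewrite gt_eqF.
have h8 : lambda2 / (4 * k1) * dotv W W = 4^-1 * (lambda2 / k1 * dotv W W).
  by field; rewrite gt_eqF.
have h9 : 0 <= lambda2 / k1 * dotv W W.
  by rewrite mulr_ge0 ?dotv_ge0// divr_ge0// ltW.
move: h1 h2 h3 h4 h5; rewrite h6 h7 h8 mulrA; lra.
Qed.

End dissipation.

(** * Absolutely continuous functions *)

(** Cousin's lemma as an induction principle: the supremum of the points t of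
    [a, b] with P a t is itself such a point, and it cannot be smaller than b. *)
Lemma interval_additive_ind (R : realType) (a b : R) (P : R -> R -> Prop) :
  a <= b -> (forall u v w, P u v -> P v w -> P u w) ->
  (forall t, a <= t -> t <= b -> exists2 e, 0 < e & forall u v,
    a <= u -> u <= t -> t <= v -> v <= b -> t - e < u -> v < t + e -> P u v) ->
  P a b.
Proof.
move=> ab Padd Ploc.
pose S := [set t | [/\ a <= t, t <= b & P a t]].
have Sa : S a.
  have [e e0 Pe] := Ploc a (lexx a) ab.
  by split => //; apply: Pe => //; rewrite ?ltrBlDr ltrDl.
have Sb : has_ubound S by exists b => t [].
have supS : has_sup S by split => //; exists a.
set s := sup S.
have as_ : a <= s by apply: ub_le_sup.
have sb : s <= b by apply: ge_sup; [exists a|move=> t []].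
have [e e0 Pe] := Ploc s as_ sb.
have Pas : P a s.
  have [t [at_ tb Pat] st] := sup_adherent e0 supS.
  apply: (Padd _ t) => //; apply: Pe => //; last by rewrite ltrDl.
  exact: ub_le_sup.
move: sb; rewrite le_eqVlt => /orP[/eqP <- //|sb].
pose v := Num.min b (s + e / 2).
have sv : s < v by rewrite lt_min sb ltrDl divr_gt0.
have vb : v <= b by rewrite ge_min lexx.
have ve : v < s + e.
  by rewrite gt_min; apply/orP; right; rewrite ltrD2l ltr_pdivrMr//; lra.
have : S v.
  split => //; first by rewrite (le_trans as_)// ltW.
  by apply: (Padd _ s) => //; apply: Pe => //; rewrite ?ltW// ltrBlDr ltrDl.
by move=> /(ub_le_sup Sb); rewrite leNgt sv.
Qed.

Section absolute_continuity.
Variables (R : realType) (a b : R).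
Implicit Types V W : normedModType R.

Lemma abs_continuous_uniform V (h : R -> V) : abs_continuous a b h ->
  forall e, 0 < e -> exists2 delta, 0 < delta & forall l r,
    a <= l -> l <= r -> r <= b -> r - l < delta -> `|h r - h l| < e.
Proof.
move=> hac e e0; have [delta d0 hd] := hac e e0; exists delta => // l r al lr rb lrd.
have := hd 1%N (fun=> l) (fun=> r); rewrite !big_ord1; apply => //.
by apply/trivIsetP => i j _ _; rewrite !ord1 eqxx.
Qed.

Lemma abs_continuous_bounded V (h : R -> V) : a <= b -> abs_continuous a b h ->
  exists2 B, 0 <= B & forall t, a <= t -> t <= b -> `|h t| <= B.
Proof.
move=> ab hac.
pose P u v := exists2 B, 0 <= B & forall t, u <= t -> t <= v -> `|h t| <= B.
apply: (@interval_additive_ind R a b P) => //.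
  move=> u v w [B B0 hB] [B' B'0 hB']; exists (B + B'); first exact: addr_ge0.
  move=> t ut tw; have [tv|/ltW vt] := leP t v.
    by rewrite (le_trans (hB _ ut tv))// lerDl.
  by rewrite (le_trans (hB' _ vt tw))// lerDr.
have [delta d0 hd] := abs_continuous_uniform hac ltr01.
move=> t at_ tb; exists delta => // u v au ut tv vb tu vt.
exists (`|h t| + 1) => [|s us sv]; first by rewrite addr_ge0.
rewrite -(subrK (h t) (h s)) (le_trans (ler_normD _ _))// addrC lerD2l.
have [st|/ltW ts] := leP s t.
  by rewrite distrC ltW// hd//; lra.
by rewrite ltW// hd//; lra.
Qed.

(** Most closure properties of absolute continuity are instances: the
    increments of g are controlled by those of two absolutely continuous
    functions. *)
Lemma abs_continuous_dom V1 V2 W (C : R) (h1 : R -> V1) (h2 : R -> V2) (g : R -> W) :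
  abs_continuous a b h1 -> abs_continuous a b h2 -> 0 <= C ->
  (forall l r, a <= l -> l <= r -> r <= b ->
     `|g r - g l| <= C * (`|h1 r - h1 l| + `|h2 r - h2 l|)) ->
  abs_continuous a b g.
Proof.
move=> ac1 ac2 C0 gle e e0.
have c0 : 0 < 2 * (C + 1) by lra.
have e'0 : 0 < e / (2 * (C + 1)) by rewrite divr_gt0.
have [d1 d10 hd1] := ac1 _ e'0; have [d2 d20 hd2] := ac2 _ e'0.
exists (Num.min d1 d2); first by rewrite lt_min d10.
move=> m l r lr tI; rewrite lt_min => /andP[s1 s2].
have {}hd1 := hd1 m l r lr tI s1; have {}hd2 := hd2 m l r lr tI s2.
apply: (@le_lt_trans _ _ (C * (\sum_k `|h1 (r k) - h1 (l k)| +
   \sum_k `|h2 (r k) - h2 (l k)|))).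
  rewrite -big_split mulr_sumr/=; apply: ler_sum => k _.
  by have [al lk rb] := lr k; exact: gle.
move: hd1 hd2; set s := e / _ => hd1 hd2.
have se : s * (2 * (C + 1)) = e by rewrite /s divfK// gt_eqF.
apply: (@le_lt_trans _ _ (C * (s + s))); first by apply: ler_wpM2l => //; rewrite lerD// ltW.
rewrite -se; nra.
Qed.

Lemma abs_continuous_lipschitz V (C : R) (g : R -> V) : 0 <= C ->
  (forall l r, a <= l -> l <= r -> r <= b -> `|g r - g l| <= C * (r - l)) ->
  abs_continuous a b g.
Proof.
move=> C0 gC e e0; exists (e / (C + 1)); first by rewrite divr_gt0// ltr_wpDl.
move=> m l r lr _; rewrite ltr_pdivlMr ?ltr_wpDl// => s.
apply: (@le_lt_trans _ _ (C * \sum_k (r k - l k))).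
  by rewrite mulr_sumr; apply: ler_sum => k _; have [? ? ?] := lr k; exact: gC.
apply: le_lt_trans s; rewrite mulrC; apply: ler_wpM2l; last by lra.
by apply: sumr_ge0 => k _; have [_ ? _] := lr k; rewrite subr_ge0.
Qed.

Lemma abs_continuous_cst V (c : V) : abs_continuous a b (fun=> c).
Proof.
by apply: (@abs_continuous_lipschitz _ 0) => // l r *; rewrite subrr normr0 mul0r.
Qed.

Lemma abs_continuousD V (g h : R -> V) : abs_continuous a b g ->
  abs_continuous a b h -> abs_continuous a b (fun t => g t + h t).
Proof.
move=> gac hac; apply: (@abs_continuous_dom _ _ _ 1 g h) => // l r _ _ _.
by rewrite mul1r (le_trans _ (ler_normD _ _))// opprD addrACA.
Qed.

Lemma abs_continuous_sum V (I : Type) (s : seq I) (F : I -> R -> V) :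
  (forall i, abs_continuous a b (F i)) ->
  abs_continuous a b (fun t => \sum_(i <- s) F i t).
Proof.
move=> Fac; elim: s => [|i s ih].
  by under eq_fun do rewrite big_nil; exact: abs_continuous_cst.
by under eq_fun do rewrite big_cons; exact: (abs_continuousD (Fac i) ih).
Qed.

Lemma abs_continuousM (g h : R -> R) : a <= b -> abs_continuous a b (g : R -> R^o) ->
  abs_continuous a b (h : R -> R^o) -> abs_continuous a b ((fun t => g t * h t) : R -> R^o).
Proof.
move=> ab gac hac.
have [B B0 gB] := abs_continuous_bounded ab gac.
have [B' B'0 hB] := abs_continuous_bounded ab hac.
apply: (@abs_continuous_dom _ _ _ (B + B') _ _ _ gac hac); first exact: addr_ge0.
move=> l r al lr rb.
have -> : g r * h r - g l * h l = g r * (h r - h l) + h l * (g r - g l) by ring.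
rewrite (le_trans (ler_normD _ _))// !normrM.
have h1 := ler_wpM2r (normr_ge0 (h r - h l)) (gB r (le_trans al lr) rb).
have h2 := ler_wpM2r (normr_ge0 (g r - g l)) (hB l al (le_trans lr rb)).
have := mulr_ge0 B0 (normr_ge0 (g r - g l)).
have := mulr_ge0 B'0 (normr_ge0 (h r - h l)).
rewrite mulrDl !mulrDr; lra.
Qed.

Lemma abs_continuousZ (c : R) (g : R -> R) : a <= b -> abs_continuous a b (g : R -> R^o) ->
  abs_continuous a b ((fun t => c * g t) : R -> R^o).
Proof. by move=> ab; apply: abs_continuousM => //; exact: abs_continuous_cst. Qed.

End absolute_continuity.

(** The two estimates at u <= t <= v bound the increment of g over a small
    interval [u, v] around t. *)
Lemma straddle (R : realType) (g : R -> R) (t D e : R) : is_derive t 1 (g : R -> R^o) D ->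
  0 < e -> exists2 delta, 0 < delta &
    forall v, `|v - t| < delta -> `|g v - g t - D * (v - t)| <= e * `|v - t|.
Proof.
move=> [gd gD] e0.
have := gd; rewrite /derivable => /cvg_ex[l hl].
have lD : l = D by rewrite -gD; apply/esym/cvg_lim.
move: hl; rewrite lD => /cvgrPdist_lt/(_ _ e0) /nbhs_ballP[delta /= d0 hd].
exists delta => // v vt.
have [->|vt0] := eqVneq v t; first by rewrite !subrr mulr0 subrr !normr0 mulr0.
have vt1 : v - t != 0 by rewrite subr_eq0.
have := hd (v - t); rewrite /ball/= sub0r normrN => /(_ vt vt1).
rewrite scaler1 subrK => /ltW h.
rewrite -ler_pdivrMr ?normr_gt0// -normfV -normrM -normrN.
suff -> : - ((g v - g t - D * (v - t)) / (v - t)) = D - (v - t)^-1 *: (g v - g t) by [].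
by rewrite /GRing.scale/=; field.
Qed.

Section monotone.
Variable R : realType.
Let mu := @lebesgue_measure R.

(** The exceptional set Z lies in an open set G of measure less than delta.
    Around a point outside Z the derivative controls the increment up to e
    times the length; around a point of Z the interval lies in G and is
    recorded in a list. Cousin's lemma assembles these local estimates; the
    recorded intervals are disjoint and of total length less than delta, so
    absolute continuity bounds their contribution by e. *)
Lemma abs_continuous_le (a b : R) (g : R -> R) : a <= b ->
  abs_continuous a b (g : R -> R^o) ->
  {ae mu, forall t, a <= t <= b -> exists2 D, is_derive t 1 (g : R -> R^o) D & D <= 0} ->
  g b <= g a.
Proof.
move=> ab gac [Z [mZ Z0 ZP]].
suff H : forall e, 0 < e -> g b - g a <= e * (b - a) + e.
  rewrite -subr_le0; apply/ler_addgt0Pl => e e0; rewrite addr0.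
  have c0 : 0 < b - a + 1 by lra.
  apply: le_trans (H _ (divr_gt0 e0 c0)) _.
  by rewrite -[X in _ + X]mulr1 -mulrDr divfK// gt_eqF.
move=> e e0; have [delta d0 hd] := gac e e0.
have Zoo : (mu Z < +oo)%E by rewrite Z0.
have [G [oG ZG muG]] := lebesgue_regularity_outer mZ Zoo d0.
have mG := open_measurable oG.
have {}muG : (mu G < delta%:E)%E.
  have -> : mu G = mu (G `\` Z).
    transitivity (mu (G `\` Z) + mu (G `&` Z))%E; first exact: measureDI.
    by rewrite setIidr// Z0 adde0.
  exact: muG.
pose len (s : seq (R * R)) := \sum_(p <- s) (p.2 - p.1).
pose var (s : seq (R * R)) := \sum_(p <- s) `|g p.2 - g p.1|.
(* The list s records the intervals around points of Z. Their total length is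
   compared with the part of G inside ]u, v], which is additive in [u, v]. *)
pose P u v := u <= v /\ exists s : seq (R * R), [/\
  all (fun p => (u <= p.1) && (p.1 <= p.2) && (p.2 <= v)) s,
  pairwise (fun p q => p.2 <= q.1) s,
  g v - g u <= e * (v - u) + var s &
  ((len s)%:E <= mu (G `&` `]u, v]%classic))%E].
have mGI (u v : R) : measurable (G `&` `]u, v]%classic) by apply: measurableI.
have [_ [s [/allP sin spw sg slen]]] : P a b.
  apply: interval_additive_ind => //.
    move=> u v w [uv [s [sin spw sg slen]]] [vw [s' [sin' spw' sg' slen']]].
    split; first exact: le_trans vw.
    exists (s ++ s'); split.
    - rewrite all_cat; apply/andP; split.
        apply: sub_all sin => p /andP[/andP[-> ->]] /= pv; exact: le_trans vw.
      by apply: sub_all sin' => p /andP[/andP[vp -> ->]]; rewrite (le_trans uv).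
    - rewrite pairwise_cat spw spw' !andbT.
      apply/allrelP => p q ps qs.
      have /andP[_ h1] := allP sin _ ps; have /andP[/andP[h2 _] _] := allP sin' _ qs.
      exact: le_trans h2.
    - by rewrite /var big_cat/=; move: sg sg'; rewrite /var; lra.
    - rewrite /len big_cat/= EFinD.
      have -> : G `&` `]u, w]%classic = (G `&` `]u, v]%classic) `|` (G `&` `]v, w]%classic).
        by rewrite -setIUr (@itv_bndbnd_setU _ _ _ (BRight v)).
      have -> : mu ((G `&` `]u, v]%classic) `|` (G `&` `]v, w]%classic)) =
          (mu (G `&` `]u, v]%classic) + mu (G `&` `]v, w]%classic))%E.
        apply: measureU; [exact: mGI|exact: mGI|].
        rewrite setIACA setIid -subset0 => x [_ /= []]; rewrite !in_itv/=.
        by move=> /andP[_ xv] /andP[vx _]; move: vx; rewrite ltNge xv.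
      exact: leeD.
  move=> t at_ tb; have [Zt|nZt] := pselect (Z t).
    have /nbhs_ballP[r /= r0 tG] := open_nbhs_nbhs (conj oG (ZG _ Zt)).
    exists r => // u v au ut tv vb tu vt; split; first exact: le_trans tv.
    exists [:: (u, v)]; split => //=.
    - by rewrite !lexx (le_trans ut tv).
    - rewrite /var big_seq1/=; have := ler_norm (g v - g u).
      have : 0 <= e * (v - u) by apply: mulr_ge0; [exact: ltW|rewrite subr_ge0; exact: le_trans tv].
      lra.
    - rewrite /len big_seq1/=.
      rewrite setIidr; last first.
        move=> x /=; rewrite in_itv/= => /andP[ux xv]; apply: tG.
        by rewrite /ball/= ltr_distlC; apply/andP; split; lra.
      rewrite /mu lebesgue_measure_itv/= lte_fin.
      have := le_trans ut tv; rewrite le_eqVlt => /orP[/eqP ->|->//].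
      by rewrite ltxx subrr.
  have [D gD D0] : exists2 D, is_derive t 1 (g : R -> R^o) D & D <= 0.
    apply: contrapT => h; apply: nZt; apply: ZP => /= h'; apply: h.
    by apply: h'; rewrite at_.
  have [r r0 gr] := straddle gD e0.
  exists r => // u v au ut tv vb tu vt; split; first exact: le_trans tv.
  exists [::]; split => //=; last by rewrite /len big_nil measure_ge0.
  rewrite /var big_nil addr0.
  have gt v' : `|v' - t| < r -> g v' - g t <= D * (v' - t) + e * `|v' - t| /\
      g t - g v' <= - (D * (v' - t)) + e * `|v' - t|.
    by move=> /gr; rewrite ler_norml => /andP[]; split; lra.
  have vr : `|v - t| < r by rewrite ltr_distlC; apply/andP; split; lra.
  have ur : `|u - t| < r by rewrite ltr_distlC; apply/andP; split; lra.
  have [h1 _] := gt v vr; have [_ h2] := gt u ur.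
  rewrite ger0_norm ?subr_ge0// in h1; rewrite ler0_norm ?subr_le0// in h2.
  have : D * (v - u) <= 0 by rewrite mulr_le0_ge0// subr_ge0 (le_trans ut).
  lra.
have lenG : len s < delta.
  rewrite -lte_fin; apply: le_lt_trans slen (le_lt_trans _ muG).
  apply: (@le_measure _ _ _ mu); rewrite ?inE; [exact: mGI|exact: mG|exact: subIsetl].
have := hd (size s) (fun k => (tnth (in_tuple s) k).1) (fun k => (tnth (in_tuple s) k).2).
have tn (F : R * R -> R) : \sum_(k < size s) F (tnth (in_tuple s) k) = \sum_(p <- s) F p.
  by rewrite [RHS]big_tnth.
rewrite (tn (fun p => p.2 - p.1)) (tn (fun p => `|g p.2 - g p.1|)) => hs.
have : var s < e.
  apply: hs => //.
    move=> k; have /sin /andP[/andP[? ?] ?] : tnth (in_tuple s) k \in s by exact: mem_tnth.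
    by split.
  apply/trivIsetP => i j _ _ ij.
  wlog : i j ij / (i < j)%N.
    move=> W; move: (ij); rewrite neq_ltn => /orP[|ji]; first exact: W.
    by rewrite setIC; apply: W => //; rewrite eq_sym.
  move=> {}ij; rewrite -subset0 => x [/=]; rewrite !in_itv/= => /andP[_ xi] /andP[jx _].
  have /(pairwiseP (0, 0)) /(_ i j (ltn_ord i) (ltn_ord j) ij) /= := spw.
  rewrite !(tnth_nth (0, 0))/= in xi jx.
  by rewrite leNgt (lt_trans jx xi).
lra.
Qed.

End monotone.

(** * Calculus along trajectories *)

Section derivatives.
Variable R : realType.
Implicit Types (g h e : R -> R) (t c : R).

Lemma is_derive_addf g h t dg dh : is_derive t 1 (g : R -> R^o) dg ->
  is_derive t 1 (h : R -> R^o) dh ->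
  is_derive t 1 ((fun u => g u + h u) : R -> R^o) (dg + dh).
Proof. exact: is_deriveD. Qed.

Lemma is_derive_mulf g h t dg dh : is_derive t 1 (g : R -> R^o) dg ->
  is_derive t 1 (h : R -> R^o) dh ->
  is_derive t 1 ((fun u => g u * h u) : R -> R^o) (g t * dh + h t * dg).
Proof. exact: is_deriveM. Qed.

Lemma is_derive_scalef g t c dg : is_derive t 1 (g : R -> R^o) dg ->
  is_derive t 1 ((fun u => c * g u) : R -> R^o) (c * dg).
Proof. exact: is_deriveZ. Qed.

Lemma is_derive_addc g t c dg : is_derive t 1 (g : R -> R^o) dg ->
  is_derive t 1 ((fun u => g u + c) : R -> R^o) dg.
Proof.
move=> gd; have := is_derive_addf gd (is_derive_cst (c : R^o) t 1).
by rewrite addr0.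
Qed.

Lemma is_derive_sumf n (h : 'I_n -> R -> R) t (dh : 'I_n -> R) :
  (forall i, is_derive t 1 (h i : R -> R^o) (dh i)) ->
  is_derive t 1 ((fun u => \sum_i h i u) : R -> R^o) (\sum_i dh i).
Proof.
move=> hd; have := is_derive_sum hd.
by have -> : \sum_i h i = (fun u => \sum_i h i u) by apply/funext => u; rewrite fct_sumE.
Qed.

Lemma is_derive_squeeze h e t : is_derive t 1 (e : R -> R^o) 0 -> e t = 0 ->
  (forall u, `|h u - h t| <= e u) -> is_derive t 1 (h : R -> R^o) 0.
Proof.
move=> [ed eD] et hle.
have : (k^-1 *: (h (k *: 1 + t) - h t) : R^o) @[k --> 0^'] --> (0 : R^o).
  move: ed => /cvg_ex[l el].
  have l0 : l = 0 by rewrite -eD; apply/esym/cvg_lim.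
  move: el; rewrite l0 => /cvgrPdist_le el; apply/cvgrPdist_le => r r0.
  have := el _ r0; apply: filterS => k; rewrite !sub0r !normrN et subr0.
  rewrite !normrM => el'; apply: (le_trans _ el'); apply: ler_wpM2l => //.
  by rewrite (le_trans (hle _))// ler_norm.
move=> hl; have hd : derivable (h : R -> R^o) t 1 by apply/cvg_ex; exists 0.
by apply: DeriveDef => //; apply/cvg_lim.
Qed.

Variable n : nat.
Implicit Types (z : R -> 'cV[R]_n) (D : 'cV[R]_n).

Lemma is_derive_coord z t D k : is_derive t 1 z D ->
  is_derive t 1 ((fun u => z u k 0) : R -> R^o) (D k 0).
Proof.
move=> [zd zD]; apply: DeriveDef; first by move/derivable_mxP : zd; exact.
by rewrite -zD derive_mx// mxE.
Qed.

Lemma is_derive_dotv_sqr z t D (c : 'cV[R]_n) : is_derive t 1 z D ->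
  is_derive t 1 ((fun u => dotv (z u - c) (z u - c)) : R -> R^o)
    (2 * dotv (z t - c) D).
Proof.
move=> zd; under eq_fun do rewrite dotvE.
have -> : 2 * dotv (z t - c) D = \sum_k ((z t - c) k 0 * D k 0 + (z t - c) k 0 * D k 0).
  by rewrite dotvE mulr_sumr; apply: eq_bigr => k _; ring.
apply: is_derive_sumf => k.
have zc : is_derive t 1 ((fun u => (z u - c) k 0) : R -> R^o) (D k 0).
  under eq_fun do rewrite mxE; apply: is_derive_addc.
  exact: is_derive_coord.
exact: is_derive_mulf.
Qed.

Lemma is_derive_dotvr z t D (c : 'cV[R]_n) : is_derive t 1 z D ->
  is_derive t 1 ((fun u => dotv c (z u)) : R -> R^o) (dotv c D).
Proof.
move=> zd; under eq_fun do rewrite dotvE; rewrite dotvE.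
by apply: is_derive_sumf => k; apply: is_derive_scalef; exact: is_derive_coord.
Qed.

(** Along z, the gap minus its linearization at z t moves by no more than |z u
    - z t|^2. *)
Lemma is_derive_proj_gap (C : set 'cV[R]_n) y z t D : closed C -> convex_set C ->
  C !=set0 -> is_derive t 1 z D ->
  is_derive t 1 ((fun u => proj_gap C y (z u)) : R -> R^o)
    (dotv (proj C (z t) - y) D).
Proof.
move=> clC cC C0 zd; set q := proj C (z t) - y.
pose psi u := proj_gap C y (z u) - dotv q (z u).
have psi0 : is_derive t 1 (psi : R -> R^o) 0.
  apply: (@is_derive_squeeze _ (fun u => dotv (z u - z t) (z u - z t))).
  - by have := is_derive_dotv_sqr (z t) zd; rewrite subrr dot0v mulr0.
  - by rewrite subrr dotv0.
  - move=> u; apply: le_trans (proj_gap_expansion clC cC C0 y (z t) (z u)).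
    rewrite /psi -/q dotvBr; move: (proj_gap _ _ _) (proj_gap _ _ _) => a b.
    by move: (dotv q _) (dotv q _) => c e; rewrite opprD addrACA -opprD.
have := is_derive_addf psi0 (is_derive_dotvr q zd).
by rewrite add0r; under eq_fun do rewrite subrK.
Qed.

End derivatives.

Section absolute_continuity.
Variables (R : realType) (n : nat) (a b : R).
Hypothesis ab : a <= b.
Implicit Types z : R -> 'cV[R]_n.

Lemma abs_continuous_coord z k : abs_continuous a b z ->
  abs_continuous a b ((fun u => z u k 0) : R -> R^o).
Proof.
move=> zac; apply: (@abs_continuous_dom _ _ _ _ _ _ 1 z z) => // l r _ _ _.
rewrite mul1r; have := ler_mx_norm (z r - z l) k 0; rewrite !mxE => h.
by rewrite (le_trans h)// lerDl.
Qed.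

Lemma abs_continuous_dotv_sqr z (c : 'cV[R]_n) : abs_continuous a b z ->
  abs_continuous a b ((fun u => dotv (z u - c) (z u - c)) : R -> R^o).
Proof.
move=> zac; under eq_fun do rewrite dotvE.
have zc k : abs_continuous a b ((fun u => (z u - c) k 0) : R -> R^o).
  under eq_fun do rewrite mxE.
  exact: abs_continuousD (abs_continuous_coord k zac) (abs_continuous_cst _ _ _).
exact: (abs_continuous_sum _ (fun k => abs_continuousM ab (zc k) (zc k))).
Qed.

Lemma dotv_le_norm (u v : 'cV[R]_n) : `|dotv u v| <= n%:R * (`|u| * `|v|).
Proof.
rewrite dotvE (le_trans (ler_norm_sum _ _ _))//.
rewrite mulr_natl -[X in _ *+ X]card_ord -sumr_const; apply: ler_sum => k _.
by rewrite normrM ler_pM// ler_mx_norm.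
Qed.

Lemma proj_norm_le (C : set 'cV[R]_n) p q : closed C -> convex_set C -> C !=set0 ->
  `|proj C q - proj C p| <= n.+1%:R * `|q - p|.
Proof.
move=> clC cC C0; apply: mx_norm_ler => [|k j]; first by rewrite mulr_ge0.
rewrite ord1; apply: sqr_le_norm; first by rewrite mulr_ge0.
rewrite (le_trans (sqr_coord_le _ k))// (le_trans (proj_nonexpansive clC cC C0 p q))//.
rewrite (le_trans (ler_norm _))// (le_trans (dotv_le_norm _ _))// exprMn -expr2.
rewrite ler_wpM2r ?sqr_ge0// -natrX ler_nat.
by rewrite (leq_trans (leqnSn n))// expnS expn1 leq_pmulr.
Qed.

(** On a compact interval the projections of z are bounded, so the gap is
    Lipschitz as a function of the position. *)
Lemma abs_continuous_proj_gap (C : set 'cV[R]_n) y z : closed C -> convex_set C ->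
  C !=set0 -> abs_continuous a b z ->
  abs_continuous a b ((fun u => proj_gap C y (z u)) : R -> R^o).
Proof.
move=> clC cC C0 zac.
have pac : abs_continuous a b (fun u => proj C (z u) - y).
  apply: (@abs_continuous_dom _ _ _ _ _ _ n.+1%:R z z) => // l r _ _ _.
  have -> : proj C (z r) - y - (proj C (z l) - y) = proj C (z r) - proj C (z l).
    by apply/colP => k; rewrite !mxE; ring.
  by rewrite (le_trans (proj_norm_le _ _ clC cC C0))// ler_wpM2l// lerDl.
have [B B0 hB] := abs_continuous_bounded ab pac.
apply: (@abs_continuous_dom _ _ _ _ _ _ (n%:R * B) z z) => //.
  by rewrite mulr_ge0.
move=> l r al lr rb.
have bd u : a <= u -> u <= b -> `|dotv (proj C (z u) - y) (z r - z l)| <=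
    n%:R * B * (`|z r - z l| + `|z r - z l|).
  move=> au ub; rewrite (le_trans (dotv_le_norm _ _))// -mulrA ler_wpM2l//.
  rewrite ler_pM// ?hB//; by rewrite lerDl.
have := bd l al (le_trans lr rb); have := bd r (le_trans al lr) rb.
have := proj_gap_lb clC C0 y (z l) (z r); have := proj_gap_ub clC C0 y (z l) (z r).
move: (proj_gap _ _ _) (proj_gap _ _ _) (dotv _ _) (dotv _ _) => p q c e.
by move=> h1 h2; rewrite !ler_norml => /andP[h3 h4] /andP[h5 h6]; apply/andP; split; lra.
Qed.

End absolute_continuity.

(** * Scalar evolution inequalities *)

Section scalar_evolution.
Variable R : realType.
Let mu := @lebesgue_measure R.
Implicit Types (z V D : R -> R).

Lemma ae_imply_lebesgue (P Q : R -> Prop) : (forall t, P t -> Q t) ->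
  {ae mu, forall t, P t} -> {ae mu, forall t, Q t}.
Proof.
by move=> PQ [Z [mZ Z0 ZP]]; exists Z; split => // t nQ; apply: ZP => /PQ.
Qed.

Lemma abs_continuous_sub (W : normedModType R) (a b a' b' : R) (g : R -> W) :
  a <= a' -> b' <= b -> abs_continuous a b g -> abs_continuous a' b' g.
Proof.
move=> aa bb gac e e0; have [delta d0 hd] := gac e e0; exists delta => // m l r lr.
by apply: hd => k; have [al lk rb] := lr k; split => //; [exact: le_trans al|exact: le_trans bb].
Qed.

(** Comparison with the linear function of slope K. *)
Lemma locally_abs_continuous_rate z (K l r : R) : 0 <= l -> l <= r ->
  locally_abs_continuous (z : R -> R^o) ->
  {ae mu, forall t : R, l <= t <= r ->
    exists2 dz, is_derive t 1 (z : R -> R^o) dz & dz <= K} ->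
  z r - z l <= K * (r - l).
Proof.
move=> l0 lr zac zd.
have zac' : abs_continuous l r (z : R -> R^o).
  by apply: (@abs_continuous_sub _ 0 (r + 1)) (zac _ _); rewrite ?lerDl//; lra.
pose h u := z u + - K * u.
have hac : abs_continuous l r (h : R -> R^o).
  apply: abs_continuousD => //; apply: abs_continuousZ => //.
  by apply: (@abs_continuous_lipschitz _ _ _ _ 1) => // a b _ ab _; rewrite mul1r ger0_norm// subr_ge0.
suff : h r <= h l by rewrite /h; lra.
apply: abs_continuous_le => //; apply: ae_imply_lebesgue zd => t zt /zt[dz dzP dzK].
exists (dz + - K * 1); last by lra.
by apply: is_derive_addf => //; apply: is_derive_scalef; exact: is_derive_id.
Qed.

(** The product of expR and z - B is nonincreasing. *)
Lemma relaxation_le z (B t : R) : 0 <= t -> locally_abs_continuous (z : R -> R^o) ->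
  {ae mu, forall t : R, 0 <= t -> exists2 dz, is_derive t 1 (z : R -> R^o) dz & dz <= B - z t} ->
  z t <= B + `|z 0 - B|.
Proof.
move=> t0 zac zd; pose h u := expR u * (z u + - B).
have expac : abs_continuous 0 t (expR : R -> R^o).
  apply: (@abs_continuous_lipschitz _ _ _ _ (expR t)); first exact: expR_ge0.
  move=> l r l0 lr rt; rewrite ger0_norm ?subr_ge0 ?ler_expR//.
  have h1 := ler_wpM2l (expR_ge0 r) (expR_ge1Dx (l - r)).
  have h2 : expR r * expR (l - r) = expR l by rewrite -expRD; congr expR; ring.
  have h3 : expR r * (r - l) <= expR t * (r - l) by rewrite ler_wpM2r ?subr_ge0 ?ler_expR.
  rewrite h2 in h1; lra.
have hac : abs_continuous 0 t (h : R -> R^o).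
  apply: abs_continuousM => //; apply: abs_continuousD; last exact: abs_continuous_cst.
  by apply: (@abs_continuous_sub _ 0 (t + 1)) (zac _ _); rewrite ?lerDl//; lra.
have : h t <= h 0.
  apply: abs_continuous_le => //; apply: ae_imply_lebesgue zd => u zu /andP[u0 ut].
  have [dz dzP dzB] := zu u0.
  exists (expR u * dz + (z u + - B) * expR u).
    by apply: is_derive_mulf; exact: is_derive_addc.
  have -> : expR u * dz + (z u + - B) * expR u = expR u * (dz + z u - B) by ring.
  by rewrite pmulr_rle0 ?expR_gt0//; lra.
rewrite /h expR0 mul1r => h0.
have h1 := le_trans h0 (ler_norm _).
have [zB|zB] := leP (z t) B; first by rewrite (le_trans zB)// lerDl.
have : 1 * (z t - B) <= expR t * (z t - B).
  apply: ler_wpM2r; first by rewrite subr_ge0 ltW.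
  by rewrite (le_trans _ (expR_ge1Dx t))// lerDl.
lra.
Qed.

(** If D t >= e at a late time, then D stays above e / 4 for a duration th
    independent of t, so V loses a fixed amount after t; this is impossible
    once V is that close to its infimum. *)
Lemma barbalat V D (kappa K : R) : 0 < kappa -> 0 <= K ->
  (forall t, 0 <= t -> 0 <= V t) ->
  (forall t r c, 0 <= t -> t <= r -> (forall u, t <= u -> u <= r -> c <= D u) ->
     V r - V t <= - (kappa * c) * (r - t)) ->
  (forall t, 0 <= D t) ->
  (forall t u, 0 <= t -> t <= u -> D t / 2 - K * (u - t) ^+ 2 <= D u) ->
  forall e, 0 < e -> exists2 T, 0 <= T & forall t, T <= t -> D t < e.
Proof.
move=> k0 K0 V0 VD D0 DK e e0.
(* As th <= 1, the parabola K r ^+ 2 stays below e / 4 up to r = th. *)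
have [th [th0 th1 Kth]] : exists th, [/\ 0 < th, th <= 1 & K * th <= e / 4].
  exists (Num.min 1 (e / (4 * (K + 1)))).
  have p : 0 < 4 * (K + 1) by lra.
  split; first by rewrite lt_min ltr01 divr_gt0.
    by rewrite ge_min lexx.
  apply: (@le_trans _ _ (K * (e / (4 * (K + 1))))).
    by rewrite ler_wpM2l// ge_min lexx orbT.
  rewrite mulrA ler_pdivrMr//; have -> : e / 4 * (4 * (K + 1)) = e * (K + 1) by field.
  nra.
pose S := [set V t | t in [set t | 0 <= t]].
have S0 : has_inf S.
  split; first by exists (V 0), 0 => //=.
  by exists 0 => _ [t t0 <-]; exact: V0.
have dec0 : 0 < kappa * (e / 4) * th by rewrite !mulr_gt0 ?divr_gt0.
have [_ [T T0 <-] VT] := inf_adherent dec0 S0.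
exists T => // t Tt; rewrite ltNge; apply/negP => eD.
have t0 := le_trans T0 Tt.
have h1 : V (t + th) - V t <= - (kappa * (e / 4)) * (t + th - t).
  apply: VD => //; first by rewrite lerDl ltW.
  move=> u tu ut; apply: le_trans (DK t u t0 tu).
  have ut0 : 0 <= u - t by lra.
  have ut1 : u - t <= th by lra.
  have : (u - t) ^+ 2 <= th.
    by rewrite expr2 (le_trans (ler_pM ut0 ut0 ut1 (le_trans ut1 th1)))// mulr1.
  move=> /(ler_wpM2l K0); lra.
have h2 : V t - V T <= - (kappa * 0) * (t - T) by apply: VD.
have h3 : inf S <= V (t + th).
  apply: ge_inf; first by case: S0.
  by exists (t + th) => //=; rewrite addr_ge0// ltW.
have e1 : t + th - t = th by ring.
by move: h1 h2; rewrite mulr0 oppr0 mul0r e1 mulNr; lra.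
Qed.

End scalar_evolution.

(** * Convergence of the algorithm *)

Section power_balance.
Variables (R : realType) (N n : nat) (A : 'M[R]_N) (lambda2 omega k1 k2 k3 : R).
Hypothesis N_gt0 : (0 < N)%N.
Hypothesis A_ge0 : forall i j, 0 <= A i j.
Hypothesis A_balanced : weight_balanced A.
Hypothesis A_connected : strongly_connected A.
Hypothesis lambda2P :
  smallest_pos_eigenvalue (2^-1 *: (laplacian A + (laplacian A)^T)) lambda2.
Hypothesis omega_gt0 : 0 < omega.
Hypothesis k1_gt : spectral_norm (laplacian A) ^+ 2 / (lambda2 * omega) < k1.
Hypothesis k2_gt : k1 ^+ 2 / lambda2 ^+ 2 < k2.
Hypothesis k3_gt0 : 0 < k3.
Implicit Types u v : 'I_N -> 'cV[R]_n.

Let row_of u k : 'cV[R]_N := \col_i u i k 0.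

Lemma sum_dotv_coord u v :
  \sum_i dotv (u i) (v i) = \sum_k dotv (row_of u k) (row_of v k).
Proof.
under eq_bigr do rewrite dotvE.
rewrite exchange_big/=; apply: eq_bigr => k _; rewrite dotvE.
by apply: eq_bigr => i _; rewrite !mxE.
Qed.

Lemma coupling_coord v k : row_of (fun i => \sum_j A i j *: (v j - v i)) k =
  - (laplacian A *m row_of v k).
Proof.
apply/colP => i; rewrite [RHS]mxE laplacianE -sumrN !mxE summxE.
by apply: eq_bigr => j _; rewrite !mxE; ring.
Qed.

(** The weights k1^-1 and (k1 k3)^-1 are those of S and W in the Lyapunov
    function. The terms Y . S coming from X' and from S cancel, and the
    remaining quadratic form splits over the coordinates of R^n. *)
Lemma power_balance (Y S W X' : 'I_N -> 'cV[R]_n) :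
  (forall i, dotv (Y i) (X' i) <= - omega * dotv (Y i) (Y i) + dotv (Y i) (S i)) ->
  \sum_i W i = 0 ->
  \sum_i dotv (Y i) (X' i)
  + k1^-1 * \sum_i dotv (S i)
      (k1 *: (W i - Y i) + k2 *: \sum_j A i j *: (S j - S i))
  + (k1 * k3)^-1 * \sum_i dotv (W i)
      (k3 *: \sum_j A i j *: ((W j - Y j) - (W i - Y i)))
  <= - (omega / 2) * \sum_i dotv (Y i) (Y i).
Proof.
move=> hX Wsum.
have k10 : 0 < k1 by apply: (k1_gt0 lambda2P omega_gt0 k1_gt).
have h1 : \sum_i dotv (Y i) (X' i) <=
    - omega * \sum_k dotv (row_of Y k) (row_of Y k) +
    \sum_k dotv (row_of Y k) (row_of S k).
  rewrite -!sum_dotv_coord mulr_sumr -big_split/=.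
  by apply: ler_sum => i _; exact: hX.
have h2 : k1^-1 * \sum_i dotv (S i)
      (k1 *: (W i - Y i) + k2 *: \sum_j A i j *: (S j - S i)) =
    \sum_k (dotv (row_of S k) (row_of W k) - dotv (row_of Y k) (row_of S k)
      - k2 / k1 * dotv (row_of S k) (laplacian A *m row_of S k)).
  rewrite sum_dotv_coord mulr_sumr; apply: eq_bigr => k _.
  have -> : row_of (fun i => k1 *: (W i - Y i) + k2 *: \sum_j A i j *: (S j - S i)) k =
      k1 *: (row_of W k - row_of Y k) +
      k2 *: row_of (fun i => \sum_j A i j *: (S j - S i)) k.
    by apply/colP => i; rewrite !mxE.
  rewrite coupling_coord !dotvL (dotvC (row_of Y k)); field.
  by rewrite gt_eqF.
have h3 : (k1 * k3)^-1 * \sum_i dotv (W i)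
      (k3 *: \sum_j A i j *: ((W j - Y j) - (W i - Y i))) =
    \sum_k (k1^-1 * dotv (row_of W k) (laplacian A *m row_of Y k)
      - k1^-1 * dotv (row_of W k) (laplacian A *m row_of W k)).
  rewrite sum_dotv_coord mulr_sumr; apply: eq_bigr => k _.
  have -> : row_of (fun i => k3 *: \sum_j A i j *: ((W j - Y j) - (W i - Y i))) k =
      k3 *: row_of (fun i => \sum_j A i j *: ((W j - Y j) - (W i - Y i))) k.
    by apply/colP => i; rewrite !mxE.
  rewrite (coupling_coord (fun i => W i - Y i)).
  have -> : row_of (fun i => W i - Y i) k = row_of W k - row_of Y k.
    by apply/colP => i; rewrite !mxE.
  rewrite mulmxBr !dotvL; field.
  by rewrite !gt_eqF.
rewrite h2 h3 (sum_dotv_coord Y Y).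
apply: (@le_trans _ _ (\sum_k (- omega * dotv (row_of Y k) (row_of Y k) +
   dotv (row_of S k) (row_of W k) -
   k2 / k1 * dotv (row_of S k) (laplacian A *m row_of S k) -
   k1^-1 * dotv (row_of W k) (laplacian A *m row_of W k) +
   k1^-1 * dotv (row_of W k) (laplacian A *m row_of Y k)))).
  rewrite -[leLHS]addrA; apply: (le_trans (lerD h1 (lexx _))).
  rewrite mulr_sumr -!big_split/= le_eqVlt; apply/orP; left; apply/eqP.
  by apply: eq_bigr => k _; ring.
rewrite mulr_sumr; apply: ler_sum => k _.
apply: (dissipation N_gt0 A_ge0 A_balanced A_connected lambda2P omega_gt0 k1_gt k2_gt).
under eq_bigr do rewrite mxE.
by rewrite -summxE Wsum mxE.
Qed.

End power_balance.

Lemma half_sqr_le (R : realType) n (u v : 'cV[R]_n) :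
  dotv u u / 2 - dotv (v - u) (v - u) <= dotv v v.
Proof.
by have := dotv_ge0 (2 *: v - u); rewrite !dotvL (dotvC u v); lra.
Qed.

Section trajectory.
Variables (R : realType) (N n : nat).
Variables (f : 'I_N -> 'cV[R]_n -> R) (Omega U : 'I_N -> set 'cV[R]_n).
Variables (d : 'I_N -> 'cV[R]_n) (A : 'M[R]_N) (omega lambda2 k1 k2 k3 : R).
Hypothesis N_gt0 : (0 < N)%N.
Hypothesis Omega_closed : forall i, closed (Omega i).
Hypothesis Omega_convex : forall i, convex_set (Omega i).
Hypothesis Omega_sub_U : forall i, Omega i `<=` U i.
Hypothesis f_loc_lipschitz : forall i, locally_lipschitz_on (U i) (f i).
Hypothesis omega_gt0 : 0 < omega.
Hypothesis f_strongly_convex : forall i, strongly_convex_on omega (Omega i) (f i).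
Hypothesis A_ge0 : forall i j, 0 <= A i j.
Hypothesis A_connected : strongly_connected A.
Hypothesis A_balanced : weight_balanced A.
Hypothesis lambda2P :
  smallest_pos_eigenvalue (2^-1 *: (laplacian A + (laplacian A)^T)) lambda2.
Hypothesis k1_gt : spectral_norm (laplacian A) ^+ 2 / (lambda2 * omega) < k1.
Hypothesis k2_gt : k1 ^+ 2 / lambda2 ^+ 2 < k2.
Hypothesis k3_gt0 : 0 < k3.

Variables (ys g : 'I_N -> 'cV[R]_n) (ss : 'cV[R]_n).
Hypothesis ys_feasible : feasible Omega d ys.
Hypothesis g_clarke : forall i, clarke_gradient (f i) (ys i) (g i).
Hypothesis ss_normal : forall i z, Omega i z -> dotv (ss - g i) (z - ys i) <= 0.

Variables x s w : 'I_N -> R -> 'cV[R]_n.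
Hypothesis sol : caratheodory_solution f Omega d A k1 k2 k3 x s w.
Hypothesis w0 : \sum_i w i 0 = 0.

Let mu := @lebesgue_measure R.
Let Y i t := proj (Omega i) (x i t) - ys i.
Let S i t := s i t - ss.
Let W i t := w i t - (ys i - d i).
Let D t := \sum_i dotv (Y i t) (Y i t).
(** The weights are those for which the products of Y and S cancel in the
    derivative and for which the terms of W carry the factor k1^-1. *)
Let V t := \sum_i proj_gap (Omega i) (ys i) (x i t)
  + (2 * k1)^-1 * \sum_i dotv (S i t) (S i t)
  + (2 * (k1 * k3))^-1 * \sum_i dotv (W i t) (W i t).

Let k1pos : 0 < k1 := k1_gt0 lambda2P omega_gt0 k1_gt.
Let ysO i : Omega i (ys i). Proof. by case: ys_feasible. Qed.
Let O0 i : Omega i !=set0. Proof. by exists (ys i). Qed.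

Let xac i : locally_abs_continuous (x i). Proof. by case: sol. Qed.
Let sac i : locally_abs_continuous (s i). Proof. by case: sol. Qed.
Let wac i : locally_abs_continuous (w i). Proof. by case: sol. Qed.
Let dyn : {ae mu, forall t : R, 0 <= t -> dynamics_at f Omega d A k1 k2 k3 x s w t}.
Proof. by case: sol. Qed.

(** Weight balance makes the total coupling vanish, so the sum of the w_i
    keeps its initial value. *)
Lemma sum_w_eq0 t : 0 <= t -> \sum_i w i t = 0.
Proof.
move=> t0; apply/colP => k; rewrite summxE mxE.
pose z u := \sum_i w i u k 0.
have zac : locally_abs_continuous (z : R -> R^o).
  move=> T T0; apply: (@abs_continuous_sum _ _ _ _ _ _ (fun i u => w i u k 0 : R^o)) => i.
  by apply: abs_continuous_coord; exact: wac.
have zd u : 0 <= u -> dynamics_at f Omega d A k1 k2 k3 x s w u ->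
    is_derive u 1 (z : R -> R^o) 0.
  move=> u0 du.
  pose v i := w i u - proj (Omega i) (x i u) + d i.
  have := @is_derive_sumf R N (fun i u => w i u k 0) u
    (fun i => (k3 *: \sum_j A i j *: (v j - v i)) k 0).
  have -> : \sum_i (k3 *: \sum_j A i j *: (v j - v i)) k 0 = 0.
    rewrite (eq_bigr (fun i => - k3 * (laplacian A *m \col_i v i k 0) i 0)) => [|i _].
      by rewrite -mulr_sumr laplacian_sum// mulr0.
    have /colP/(_ i) := coupling_coord A v k; rewrite [LHS]mxE [RHS]mxE => h.
    by rewrite mxE h mulrN mulNr.
  by apply => i; apply: is_derive_coord; case: (du i).
have z0 : z 0 = 0 by rewrite /z -summxE w0 mxE.
have h1 : z t - z 0 <= 0 * (t - 0).
  apply: locally_abs_continuous_rate => //.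
  apply: ae_imply_lebesgue dyn => u du /andP[u0 _].
  by exists 0 => //; apply: zd => //; exact: du.
have h2 : -1 * z t - -1 * z 0 <= 0 * (t - 0).
  apply: (@locally_abs_continuous_rate _ (fun u => -1 * z u)) => //.
    by move=> T T0; apply: abs_continuousZ; [exact: ltW|exact: zac].
  apply: ae_imply_lebesgue dyn => u du /andP[u0 _].
  exists (-1 * 0); last by rewrite mulr0.
  by apply: is_derive_scalef; apply: zd => //; exact: du.
by move: h1 h2; rewrite -/(z t) z0; lra.
Qed.

(** The normality of ss - g_i at ys_i, the variational inequality of the
    projection and strong monotonicity bound the primal power by - omega |Y|^2
    + Y . S; the rest is the power balance. *)
Lemma lyapunov_derive u : 0 <= u -> dynamics_at f Omega d A k1 k2 k3 x s w u ->
  exists2 dV, is_derive u 1 (V : R -> R^o) dV & dV <= - (omega / 2) * D u.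
Proof.
move=> u0 du.
pose X' i := derive1 (x i) u.
have xd i : is_derive u 1 (x i) (X' i).
  by rewrite /X' derive1E; apply: derivableP; case: (du i).
pose S' i := k1 *: (W i u - Y i u) + k2 *: \sum_j A i j *: (S j u - S i u).
pose W' i := k3 *: \sum_j A i j *: ((W j u - Y j u) - (W i u - Y i u)).
have WY i : w i u - proj (Omega i) (x i u) + d i = W i u - Y i u.
  by apply/colP => k; rewrite !mxE; ring.
have sd i : is_derive u 1 (s i) (S' i).
  have -> : S' i = k1 *: (w i u - proj (Omega i) (x i u) + d i) +
      k2 *: \sum_j A i j *: (s j u - s i u); last by case: (du i).
  rewrite /S' WY; congr (_ + _ *: _); apply: eq_bigr => j _; congr (_ *: _).
  by apply/colP => k; rewrite !mxE; ring.
have wd i : is_derive u 1 (w i) (W' i).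
  have -> : W' i = k3 *: \sum_j A i j *: ((w j u - proj (Omega j) (x j u) + d j) -
      (w i u - proj (Omega i) (x i u) + d i)); last by case: (du i).
  by rewrite /W'; congr (_ *: _); apply: eq_bigr => j _; rewrite !WY.
exists (\sum_i dotv (Y i u) (X' i) + (2 * k1)^-1 * (\sum_i 2 * dotv (S i u) (S' i))
  + (2 * (k1 * k3))^-1 * (\sum_i 2 * dotv (W i u) (W' i))).
  apply: is_derive_addf; first apply: is_derive_addf.
  - by apply: is_derive_sumf => i; exact: is_derive_proj_gap.
  - by apply/is_derive_scalef/is_derive_sumf => i; exact: is_derive_dotv_sqr.
  - by apply/is_derive_scalef/is_derive_sumf => i; exact: is_derive_dotv_sqr.
have hX i : dotv (Y i u) (X' i) <=
    - omega * dotv (Y i u) (Y i u) + dotv (Y i u) (S i u).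
  have [_ [h hf hX] _ _] := du i; rewrite /X' -hX.
  have yO : Omega i (proj (Omega i) (x i u)) by exact: proj_in.
  have h1 := proj_variational (@Omega_closed i) (@Omega_convex i) (O0 i) (x i u) (ysO i).
  have h2 := f_strongly_convex yO (ysO i) hf (g_clarke i).
  have h3 := ss_normal yO.
  move: h1 h2 h3; rewrite enorm_sqr /Y /S; set y := proj _ _ => h1 h2 h3.
  have -> : dotv (y - ys i) (y - x i u - h + s i u) =
      dotv (x i u - y) (ys i - y) - dotv (y - ys i) (h - g i) +
      dotv (ss - g i) (y - ys i) + dotv (y - ys i) (s i u - ss).
    rewrite (dotvC (x i u - y)) (dotvC (ss - g i)) -(opprB y (ys i)) dotvNl.
    by rewrite -dotvNr -!dotvBr -!dotvDr; congr (dotv _ _); apply/colP => k; rewrite !mxE; ring.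
  lra.
have Wsum : \sum_i W i u = 0.
  by rewrite /W sumrB sum_w_eq0// sumrB; case: ys_feasible => -> _; rewrite subrr subr0.
have := power_balance N_gt0 A_ge0 A_balanced A_connected lambda2P omega_gt0 k1_gt
  k2_gt k3_gt0 hX Wsum.
rewrite -!mulr_sumr.
have -> : (2 * k1)^-1 * (2 * \sum_i dotv (S i u) (S' i)) =
    k1^-1 * \sum_i dotv (S i u) (S' i) by field; rewrite gt_eqF.
have -> : (2 * (k1 * k3))^-1 * (2 * \sum_i dotv (W i u) (W' i)) =
    (k1 * k3)^-1 * \sum_i dotv (W i u) (W' i) by field; rewrite !gt_eqF.
exact.
Qed.

Lemma lyapunov_ac : locally_abs_continuous (V : R -> R^o).
Proof.
move=> T T0; have T0' := ltW T0.
apply: abs_continuousD; first apply: abs_continuousD.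
- have h i := abs_continuous_proj_gap T0' (ys i) (@Omega_closed i) (@Omega_convex i)
    (O0 i) (@xac i T T0).
  exact: (abs_continuous_sum _ h).
- have h i := abs_continuous_dotv_sqr T0' ss (@sac i T T0).
  exact: (abs_continuousZ _ T0' (abs_continuous_sum _ h)).
- have h i := abs_continuous_dotv_sqr T0' (ys i - d i) (@wac i T T0).
  exact: (abs_continuousZ _ T0' (abs_continuous_sum _ h)).
Qed.

Lemma D_ge0 t : 0 <= D t.
Proof. by apply: sumr_ge0 => i _; exact: dotv_ge0. Qed.

Lemma lyapunov_rate t r c : 0 <= t -> t <= r ->
  (forall u, t <= u -> u <= r -> c <= D u) ->
  V r - V t <= - (omega / 2 * c) * (r - t).
Proof.
move=> t0 tr cD; apply: locally_abs_continuous_rate => //; first exact: lyapunov_ac.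
apply: ae_imply_lebesgue dyn => u du /andP[tu ur].
have u0 := le_trans t0 tu.
have [dV dVP dVD] := lyapunov_derive u0 (du u0).
exists dV => //; apply: (le_trans dVD).
by rewrite mulNr lerN2 ler_wpM2l ?cD// divr_ge0// ltW.
Qed.

Lemma lyapunov_le t : 0 <= t -> V t <= V 0.
Proof.
move=> t0; have := @lyapunov_rate 0 t 0 (lexx _) t0 (fun u _ _ => D_ge0 u).
by rewrite mulr0 oppr0 mul0r subr_le0.
Qed.

Let gap_ge i t : 2^-1 * dotv (Y i t) (Y i t) <= proj_gap (Omega i) (ys i) (x i t).
Proof. exact: proj_gap_ge. Qed.

Lemma lyapunov_bound_D t : 2^-1 * D t + (2 * k1)^-1 * \sum_i dotv (S i t) (S i t) <= V t.
Proof.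
have h : 2^-1 * D t <= \sum_i proj_gap (Omega i) (ys i) (x i t).
  by rewrite mulr_sumr; apply: ler_sum => i _.
have : 0 <= (2 * (k1 * k3))^-1 * \sum_i dotv (W i t) (W i t).
  apply: mulr_ge0; last by apply: sumr_ge0 => i _; exact: dotv_ge0.
  by rewrite invr_ge0 !mulr_ge0// ltW.
rewrite /V; lra.
Qed.

Lemma lyapunov_ge0 t : 0 <= V t.
Proof.
apply: le_trans (lyapunov_bound_D t); apply: addr_ge0.
  by rewrite mulr_ge0// D_ge0.
apply: mulr_ge0; first by rewrite invr_ge0 mulr_ge0// ltW.
by apply: sumr_ge0 => i _; exact: dotv_ge0.
Qed.

Let sum_term (F : 'I_N -> R) i : (forall j, 0 <= F j) -> F i <= \sum_j F j.
Proof. by move=> F0; rewrite (bigD1 i)//= lerDl sumr_ge0. Qed.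

Lemma Y_bounded i t : 0 <= t -> dotv (Y i t) (Y i t) <= 2 * V 0.
Proof.
move=> t0; have h1 := lyapunov_bound_D t; have h2 := lyapunov_le t0.
have h3 : dotv (Y i t) (Y i t) <= D t by apply: (@sum_term (fun j => dotv (Y j t) (Y j t))) => j; exact: dotv_ge0.
have : 0 <= (2 * k1)^-1 * \sum_i dotv (S i t) (S i t).
  apply: mulr_ge0; first by rewrite invr_ge0 mulr_ge0// ltW.
  by apply: sumr_ge0 => j _; exact: dotv_ge0.
lra.
Qed.

Lemma S_bounded i t : 0 <= t -> dotv (S i t) (S i t) <= 2 * k1 * V 0.
Proof.
move=> t0; have h1 := lyapunov_bound_D t; have h2 := lyapunov_le t0.
have h3 : dotv (S i t) (S i t) <= \sum_j dotv (S j t) (S j t).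
  by apply: (@sum_term (fun j => dotv (S j t) (S j t))) => j; exact: dotv_ge0.
apply: (le_trans h3); rewrite -ler_pdivrMl ?mulr_gt0//.
have := D_ge0 t; lra.
Qed.

(** The points y_i stay in a compact part of Omega_i, by the bound on the
    Lyapunov function. *)
Lemma gradient_bounded i : exists2 G : R, 0 < G & forall t, 0 <= t ->
  forall h, clarke_gradient (f i) (proj (Omega i) (x i t)) h -> forall k, `|h k 0| <= G.
Proof.
have [|G G0 hG] := clarke_bounded (@f_loc_lipschitz i)
  (@compact_dotv_le R n (Omega i) (ys i) (2 * V 0) (@Omega_closed i)).
  by move=> p [/Omega_sub_U].
exists G => // t t0; apply: hG; split; first exact: proj_in.
by rewrite /= -opprB dotvNl dotvNr opprK; exact: Y_bounded.
Qed.

(** Each coordinate z of x_i solves z' = b - z for almost every time, with an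
    input b bounded by B; it stays bounded by relaxation, and then so does its
    derivative. *)
Lemma x_lipschitz_coord i k : exists2 K : R, 0 <= K & forall l r, 0 <= l -> l <= r ->
  `|x i r k 0 - x i l k 0| <= K * (r - l).
Proof.
have [G G0 hG] := gradient_bounded i.
pose B := (`|ys i k 0| + (1 + 2 * V 0)) + G + (`|ss k 0| + (1 + 2 * k1 * V 0)).
pose z u := x i u k 0.
have zac : locally_abs_continuous (z : R -> R^o).
  by move=> T T0; apply: abs_continuous_coord; exact: xac.
have zd u : 0 <= u -> dynamics_at f Omega d A k1 k2 k3 x s w u ->
    exists2 b, is_derive u 1 (z : R -> R^o) (b - z u) & `|b| <= B.
  move=> u0 du; have [xd [h hf hX] _ _] := du i.
  exists (proj (Omega i) (x i u) k 0 - h k 0 + s i u k 0).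
    have -> : proj (Omega i) (x i u) k 0 - h k 0 + s i u k 0 - z u =
        (proj (Omega i) (x i u) - x i u - h + s i u) k 0 by rewrite !mxE /z; ring.
    by rewrite hX; apply: is_derive_coord; rewrite derive1E; exact: derivableP.
  have b1 : `|Y i u k 0| <= 1 + 2 * V 0.
    by apply: sqr_le_normD1; rewrite (le_trans (sqr_coord_le _ _))// Y_bounded.
  have b2 : `|S i u k 0| <= 1 + 2 * k1 * V 0.
    by apply: sqr_le_normD1; rewrite (le_trans (sqr_coord_le _ _))// S_bounded.
  have b3 := hG u u0 h hf k.
  have -> : proj (Omega i) (x i u) k 0 - h k 0 + s i u k 0 =
     (ys i k 0 + Y i u k 0) - h k 0 + (ss k 0 + S i u k 0) by rewrite !mxE; ring.
  rewrite (le_trans (ler_normD _ _))// lerD//.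
    rewrite (le_trans (ler_normB _ _))// lerD// (le_trans (ler_normD _ _))// lerD//.
  by rewrite (le_trans (ler_normD _ _))// lerD.
pose M := B + (`|z 0 - B| + `|- z 0 - B|).
have zM t : 0 <= t -> `|z t| <= M.
  move=> t0; have h1 : z t <= B + `|z 0 - B|.
    apply: relaxation_le => //; apply: ae_imply_lebesgue dyn => u du u0.
    have [b bd bB] := zd u u0 (du u0); exists (b - z u) => //.
    by rewrite lerD2r (le_trans (ler_norm _)).
  have h2 : -1 * z t <= B + `|-1 * z 0 - B|.
    apply: (@relaxation_le _ (fun u => -1 * z u)) => //.
      by move=> T T0; apply: abs_continuousZ; [exact: ltW|exact: zac].
    apply: ae_imply_lebesgue dyn => u du u0.
    have [b bd bB] := zd u u0 (du u0); exists (-1 * (b - z u)); first exact: is_derive_scalef.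
    have := ler_norm (- b); rewrite normrN; lra.
  rewrite !mulN1r in h2; rewrite ler_norml /M.
  have := normr_ge0 (z 0 - B); have := normr_ge0 (- z 0 - B).
  by move=> ? ?; apply/andP; split; lra.
have B0 : 0 <= B.
  have V0 := lyapunov_ge0 0.
  by rewrite /B !addr_ge0// ?(ltW G0)// !mulr_ge0// ltW.
have KM : 0 <= B + M by rewrite /M; apply: addr_ge0 => //; apply: addr_ge0 => //; exact: addr_ge0.
exists (B + M) => // l r l0 lr.
have h1 : z r - z l <= (B + M) * (r - l).
  apply: locally_abs_continuous_rate => //; apply: ae_imply_lebesgue dyn => u du /andP[lu _].
  have u0 := le_trans l0 lu.
  have [b bd bB] := zd u u0 (du u0); exists (b - z u) => //.
  have := zM u u0; have := ler_norm (- z u); have := ler_norm b; rewrite normrN; lra.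
have h2 : -1 * z r - -1 * z l <= (B + M) * (r - l).
  apply: (@locally_abs_continuous_rate _ (fun u => -1 * z u)) => //.
    by move=> T T0; apply: abs_continuousZ; [exact: ltW|exact: zac].
  apply: ae_imply_lebesgue dyn => u du /andP[lu _].
  have u0 := le_trans l0 lu.
  have [b bd bB] := zd u u0 (du u0); exists (-1 * (b - z u)); first exact: is_derive_scalef.
  have := zM u u0; have := ler_norm (z u); have := ler_norm (- b); rewrite normrN; lra.
by rewrite ler_norml; move: h1 h2; rewrite /z => h1 h2; apply/andP; split; lra.
Qed.

Lemma x_lipschitz : exists2 K : R, 0 <= K & forall i t u, 0 <= t -> t <= u ->
  dotv (x i u - x i t) (x i u - x i t) <= K * (u - t) ^+ 2.
Proof.
have /choice[K KP] : forall ik : 'I_N * 'I_n, exists K : R, 0 <= K /\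
    forall l r, 0 <= l -> l <= r -> `|x ik.1 r ik.2 0 - x ik.1 l ik.2 0| <= K * (r - l).
  by move=> [i k]; have [K K0 KP] := x_lipschitz_coord i k; exists K.
exists (\sum_i \sum_k K (i, k) ^+ 2).
  by apply: sumr_ge0 => i _; apply: sumr_ge0 => k _; exact: sqr_ge0.
move=> i t u t0 tu.
apply: (@le_trans _ _ ((\sum_k K (i, k) ^+ 2) * (u - t) ^+ 2)); last first.
  rewrite ler_wpM2r ?sqr_ge0//.
  apply: (@sum_term (fun i => \sum_k K (i, k) ^+ 2)) => j.
  by apply: sumr_ge0 => k _; exact: sqr_ge0.
rewrite dotvE mulr_suml; apply: ler_sum => k _.
have [K0 /(_ _ _ t0 tu) h] := KP (i, k).
rewrite -expr2 -exprMn !mxE -(real_normK (num_real _)) ler_sqr ?nnegrE// mulr_ge0// subr_ge0//.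
Qed.

Lemma D_cvg e : 0 < e -> exists2 T, 0 <= T & forall t, T <= t -> D t < e.
Proof.
have [K K0 KP] := x_lipschitz.
have k0 : 0 < omega / 2 by rewrite divr_gt0.
have NK : 0 <= N%:R * K by rewrite mulr_ge0.
apply: (@barbalat R V D _ _ k0 NK) => [t _||t|t u t0 tu]; first exact: lyapunov_ge0.
- exact: lyapunov_rate.
- exact: D_ge0.
have h i : dotv (Y i t) (Y i t) / 2 - K * (u - t) ^+ 2 <= dotv (Y i u) (Y i u).
  have h1 := KP i t u t0 tu.
  have h2 := proj_nonexpansive (@Omega_closed i) (@Omega_convex i) (O0 i) (x i t) (x i u).
  have h3 := half_sqr_le (Y i t) (Y i u).
  have h4 : dotv (proj (Omega i) (x i u) - proj (Omega i) (x i t))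
      (proj (Omega i) (x i u) - proj (Omega i) (x i t)) =
      dotv (Y i u - Y i t) (Y i u - Y i t).
    by congr dotv; apply/colP => k; rewrite !mxE; ring.
  move: h3 h2; rewrite h4; move: (Y i t) (Y i u) (x i t) (x i u) h1 => *; lra.
have : \sum_i (dotv (Y i t) (Y i t) / 2 - K * (u - t) ^+ 2) <= D u.
  by apply: ler_sum => i _; exact: h.
by rewrite sumrB -mulr_suml sumr_const card_ord -(mulrA N%:R) mulr_natl.
Qed.

Lemma proj_trajectory_cvg i : proj (Omega i) (x i t) @[t --> +oo] --> ys i.
Proof.
apply/cvgrPdist_lt => e e0.
have e20 : 0 < e / 2 by rewrite divr_gt0.
have [T T0 DT] := D_cvg (exprn_gt0 2 e20).
near=> t.
have tT : T <= t by near: t; apply: nbhs_pinfty_ge; exact: num_real.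
apply: (@le_lt_trans _ _ (e / 2)); last by rewrite ltr_pdivrMr//; lra.
apply: mx_norm_ler => [|k j]; first exact: ltW.
rewrite ord1; apply: sqr_le_norm; first exact: ltW.
apply: le_trans (ltW (DT t tT)); apply: (le_trans (sqr_coord_le _ _)).
rewrite -opprB dotvNl dotvNr opprK.
by apply: (@sum_term (fun j => dotv (Y j t) (Y j t))) => l; exact: dotv_ge0.
Unshelve. all: by end_near. Qed.

End trajectory.

Theorem theorem2 (R : realType) (N n : nat) (N_ge2 : (2 <= N)%N)
  (f : 'I_N -> 'cV[R]_n -> R) (Omega U : 'I_N -> set 'cV[R]_n)
  (d : 'I_N -> 'cV[R]_n) (A : 'M[R]_N) (omega lambda2 k1 k2 k3 : R)
  (Omega_closed : forall i, closed (Omega i))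
  (Omega_convex : forall i, convex_set (Omega i))
  (U_open : forall i, open (U i))
  (U_convex : forall i, convex_set (U i))
  (Omega_sub_U : forall i, Omega i `<=` U i)
  (f_convex : forall i, convex_function (U i) (f i))
  (f_loc_lipschitz : forall i, locally_lipschitz_on (U i) (f i))
  (omega_gt0 : 0 < omega)
  (f_strongly_convex : forall i, strongly_convex_on omega (Omega i) (f i))
  (slater_cond : slater Omega d)
  (A_ge0 : forall i j, 0 <= A i j)
  (A_connected : strongly_connected A)
  (A_balanced : weight_balanced A)
  (lambda2P : smallest_pos_eigenvalue
                (2^-1 *: (laplacian A + (laplacian A)^T)) lambda2)
  (k1_gt : spectral_norm (laplacian A) ^+ 2 / (lambda2 * omega) < k1)
  (k2_gt : k1 ^+ 2 / lambda2 ^+ 2 < k2)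
  (k3_gt0 : 0 < k3) :
  exists ystar : 'I_N -> 'cV[R]_n,
    [/\ optimal f Omega d ystar,
        forall z, optimal f Omega d z -> z = ystar &
        forall x s w : 'I_N -> R -> 'cV[R]_n,
          caratheodory_solution f Omega d A k1 k2 k3 x s w ->
          \sum_i w i 0 = 0 ->
          forall i, proj (Omega i) (x i t) @[t --> +oo] --> ystar i].
Proof.
have N_gt0 : (0 < N)%N by exact: leq_trans N_ge2.
have [ys ysopt] := optimal_exists Omega_convex U_open U_convex Omega_sub_U f_convex
  slater_cond Omega_closed f_loc_lipschitz omega_gt0 f_strongly_convex.
have [g [ss gsP]] := kkt Omega_convex U_open U_convex Omega_sub_U f_convex
  slater_cond ysopt.
have [ysfeas _] := ysopt.
have g_clarke i : clarke_gradient (f i) (ys i) (g i).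
  have [gi _] := gsP i; apply: subgradient_clarke gi.
  by apply: open_nbhs_nbhs; split => //; apply: Omega_sub_U; case: ysfeas.
exists ys; split => //.
  move=> z zopt; exact: (optimal_unique Omega_convex U_open U_convex Omega_sub_U
    f_convex slater_cond omega_gt0 f_strongly_convex ysopt zopt).
move=> x s w sol w0 i.
exact: (proj_trajectory_cvg N_gt0 Omega_closed Omega_convex Omega_sub_U
  f_loc_lipschitz omega_gt0 f_strongly_convex A_ge0 A_connected A_balanced lambda2P
  k1_gt k2_gt k3_gt0 ysfeas g_clarke (fun i => proj2 (gsP i)) sol w0).
Qed.
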